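(* Let $p\ge 1$ be an integer. Suppose that $f:\mathbb{R}^n\to\mathbb{R}$ is $p$-times differentiable with $L$-Lipschitz continuous $p$th-order derivative, i.e. $\|\nabla^p f(x)-\nabla^p f(y)\|\le L\|x-y\|$ for all $x,y\in\mathbb{R}^n$, and that $f$ is bounded from below: $f(x)\ge f_{low}$ for all $x\in\mathbb{R}^n$. Then Algorithm 2 (defined in the context), started from $z_0\in\mathbb{R}^n$ with initial estimate $L_0>0$ and tolerance $\epsilon>0$, and with $m=(p-1)n+1$, requires at most $$\mathcal{O}\left(n^{1/p}L_{\max}^{1/p}\,(f(z_0)-f_{low})\,\epsilon^{-\frac{p+1}{p}}\right)$$ calls to the oracle of order $(p-1)$ to find an $\epsilon$-approximate stationary point of $f$, i.e. a point $\bar x$ with $\|\nabla f(\bar x)\|\le\epsilon$. Here $L_{\max}=\max\{L_0,2L\}$.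
   Context: Notation. $\|\cdot\|$ is the Euclidean norm on $\mathbb{R}^n$; $e_1,\dots,e_n$ is the canonical basis. $\nabla^q f(x)$ is the $q$th derivative, a symmetric $q$-linear form ($\nabla^0 f=f$; $\nabla f(x)$ is identified with the gradient vector). For a $q$-linear form $T$ (not necessarily symmetric), $\|T\|=\max_{\|h_1\|,\dots,\|h_q\|\le 1}|T[h_1,\dots,h_q]|$ and $T[h]^q=T[h,\dots,h]$. For a symmetric $(q-1)$-linear form $E$ and a vector $e$, $E\otimes e$ is the $q$-linear form $(E\otimes e)[h_1,\dots,h_q]=E[h_1,\dots,h_{q-1}]\langle e,h_q\rangle$ (for $q=1$, $E$ is a scalar). Algorithm 1: $(z^+,\alpha)=\texttt{LazyTensorSteps}(x,T,\sigma,m,\epsilon)$, where $T$ is a $p$-linear form, $\sigma>0$, $m\ge1$ an integer, $\epsilon>0$. Step 0: set $x_0:=x$, $\tilde x_0:=x$, $t:=0$. Step 1: if $t=m$, stop and return $(\tilde x_t,\texttt{success})$. Step 2: compute $x_{t+1}$ as an approximate solution to the problem of minimizing over $y\in\mathbb{R}^n$ the model $M_{x_t,\sigma,p}(y)=f(x_t)+\sum_{i=1}^{p-1}\frac{1}{i!}\nabla^i f(x_t)[y-x_t]^i+\frac1{p!}T[y-x_t]^p+\frac{\sigma}{(p+1)!}\|y-x_t\|^{p+1}$, such that $M_{x_t,\sigma,p}(x_{t+1})\le f(x_t)$ and $\|\nabla M_{x_t,\sigma,p}(x_{t+1})\|\le\frac{\sigma}{2p!}\|x_{t+1}-x_t\|^p$.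 Let $\tilde x_{t+1}$ be a minimizer of $f$ over $\{\tilde x_t,x_{t+1}\}$. Step 3: if $\|\nabla f(x_{t+1})\|\le\epsilon$, stop and return $(x_{t+1},\texttt{solution})$. Step 4: if $f(x_0)-f(\tilde x_{t+1})\ge\frac{\epsilon^{(p+1)/p}}{2^6\cdot3^{1/p}\cdot\sigma^{1/p}\cdot(p+1)!}(t+1)$, set $t:=t+1$ and go to Step 1; otherwise stop and return $(\tilde x_{t+1},\texttt{halt})$. Algorithm 2. Step 0: given $z_0\in\mathbb{R}^n$, $L_0>0$, $\epsilon>0$, integer $m\ge1$, set $k:=0$. Step 1: if $\|\nabla f(z_k)\|\le\epsilon$, stop. Step 2: set $\sigma_k=11(p+1)L_km$ and $h_k=\frac{4}{\sigma_k\sqrt n}\Bigl[\frac{\sigma_k^p\,\epsilon^{(p+1)/p}}{(8(p+1))^p\cdot2^7\cdot3^{1/p}\sigma_k^{1/p}}\Bigr]^{\frac1{p+1}}$, and compute $T_k=\sum_{i=1}^n\Bigl(\frac{\nabla^{p-1}f(z_k+h_ke_i)-\nabla^{p-1}f(z_k)}{h_k}\Bigr)\otimes e_i$. Step 3: $(z_{k+1},\alpha_k)=\texttt{LazyTensorSteps}(z_k,T_k,\sigma_k,m,\epsilon)$. Step 4: $L_{k+1}=2L_k$ if $\alpha_k=\texttt{halt}$; $L_{k+1}=L_k$ if $\alpha_k=\texttt{solution}$; $L_{k+1}=L_k/2$ if $\alpha_k=\texttt{success}$. Step 5: set $k:=k+1$ and go back to Step 1. Oracle calls. For $x\in\mathbb{R}^n$,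 a single call to the oracle of order $(p-1)$ corresponds to the computation of any nonempty subset of $\{f(x),\nabla f(x),\dots,\nabla^{p-1}f(x)\}$. The accounting is: each iteration $t$ of Algorithm 1 computes $\{f(x_t),\nabla f(x_t),\dots,\nabla^{p-1}f(x_t)\}$ and $\{f(x_{t+1}),\nabla f(x_{t+1})\}$, which amounts to two oracle calls, so each run of Algorithm 1 uses at most $2m$ calls; each iteration of Algorithm 2 executes Algorithm 1, computes $\nabla f(z_k)$ in Step 1, and computes $\nabla^{p-1}f(z_k+h_ke_i)$, $i=1,\dots,n$, in Step 2, and therefore uses at most $2m+(1+n)$ oracle calls. *)

(* Defs.v *)
From HB Require Import structures.
From mathcomp Require Import all_boot all_order all_algebra.
From mathcomp Require Import all_classical all_reals all_analysis.

Set Implicit Arguments.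
Unset Strict Implicit.
Unset Printing Implicit Defensive.

Import Order.TTheory GRing.Theory Num.Theory.
Import numFieldNormedType.Exports.

Local Open Scope classical_set_scope.
Local Open Scope ring_scope.

Section Euclidean.
Context {R : realType} {n : nat}.

Definition dot (u v : 'rV[R]_n) : R := \sum_(i < n) u 0 i * v 0 i.

(* The library norm on 'rV[R]_n is the sup norm, hence this definition. The two
   norms being equivalent, differentiability is unaffected. *)
Definition enorm (v : 'rV[R]_n) : R := Num.sqrt (dot v v).

Definition basis_vec (i : 'I_n) : 'rV[R]_n := delta_mx 0 i.

End Euclidean.

Section Derivatives.
Context {R : realType} {n : nat}.
Implicit Types (f : 'rV[R]_n -> R) (x h : 'rV[R]_n) (hs : seq 'rV[R]_n).

(* A q-linear form T is represented by its values T [:: h_1; ...; h_q]; its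
   values on lists of another length are irrelevant. *)
Definition form := seq 'rV[R]_n -> R.

Definition pow_eval (q : nat) (T : form) h : R := T (nseq q h).

(* On q-linear forms the set is bounded and the supremum is attained. *)
Definition form_norm (q : nat) (T : form) : R :=
  sup [set r | exists hs, [/\ size hs = q,
                              (forall h, h \in hs -> enorm h <= 1) &
                              r = `|T hs|]].

(* (E (x) e)[h_1, ..., h_q] = E[h_1, ..., h_(q-1)] <e, h_q> *)
Definition otimes (E : form) (e : 'rV[R]_n) : form :=
  fun hs => E (take (size hs).-1 hs) * dot e (last 0 hs).

(* nabla f x [:: h_1; ...; h_q] is the q-th derivative of f at x applied to
   h_1, ..., h_q; the last slot corresponds to the outermost derivative. *)
Fixpoint nabla f x hs : R :=
  if hs is h :: hs' then nabla (fun y => 'd f y h) x hs' else f x.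

(* f is q times Frechet differentiable everywhere; differentiability of the
   form-valued map x |-> nabla f x is expressed on its values at fixed vectors,
   which is the same thing since the space of forms is finite-dimensional. *)
Fixpoint times_differentiable (q : nat) f : Prop :=
  if q is q'.+1 then
    (forall x, differentiable f x) /\
    (forall h, times_differentiable q' (fun y => 'd f y h))
  else True.

Definition grad f x : 'rV[R]_n := \row_(i < n) 'd f x (basis_vec i).

End Derivatives.

Arguments form : clear implicits.

Inductive outcome := success | solution | halt.

Section Algorithms.
Context {R : realType} {n : nat}.
Implicit Types (f : 'rV[R]_n -> R) (x y z : 'rV[R]_n) (T : form R n).
Implicit Types (s eps : R) (p m t c : nat).

(* M_{x,s,p}(y), with s the regularization parameter sigma *)
Definition model f p T s x y : R :=
  f x + \sum_(1 <= i < p) pow_eval i (nabla f x) (y - x) / i`!%:R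
      + pow_eval p T (y - x) / p`!%:R
      + s / p.+1`!%:R * enorm (y - x) ^+ p.+1.

Definition approx_min f p T s x x' : Prop :=
  model f p T s x x' <= f x /\
  enorm (grad (model f p T s x) x') <= s / (2 * p`!%:R) * enorm (x' - x) ^+ p.

Definition minimizer2 f x y z : Prop :=
  [/\ z = x \/ z = y, f z <= f x & f z <= f y].

Definition eps_pow p eps : R := eps `^ (p.+1%:R / p%:R).

Definition enough_decrease f p s eps x0 t (z : 'rV[R]_n) : Prop :=
  f x0 - f z >=
    eps_pow p eps /
      (2 ^+ 6 * 3 `^ (p%:R^-1) * s `^ (p%:R^-1) * p.+1`!%:R) * t.+1%:R.

(* lazy_loop f p T s m eps x0 t x xt z a c: from iteration t, with current
   iterate x = x_t and current best point xt = ~x_t, the inner loop may return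
   (z, a) after using c oracle calls, each executed iteration costing two. *)
Inductive lazy_loop f p T s m eps x0 :
    nat -> 'rV[R]_n -> 'rV[R]_n -> 'rV[R]_n -> outcome -> nat -> Prop :=
| Lazy_success x xt :
    lazy_loop f p T s m eps x0 m x xt xt success 0
| Lazy_solution t x xt x' xt' :
    t != m -> approx_min f p T s x x' -> minimizer2 f xt x' xt' ->
    enorm (grad f x') <= eps ->
    lazy_loop f p T s m eps x0 t x xt x' solution 2
| Lazy_halt t x xt x' xt' :
    t != m -> approx_min f p T s x x' -> minimizer2 f xt x' xt' ->
    eps < enorm (grad f x') ->
    ~ enough_decrease f p s eps x0 t xt' ->
    lazy_loop f p T s m eps x0 t x xt xt' halt 2
| Lazy_continue t x xt x' xt' z a c :
    t != m -> approx_min f p T s x x' -> minimizer2 f xt x' xt' ->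
    eps < enorm (grad f x') ->
    enough_decrease f p s eps x0 t xt' ->
    lazy_loop f p T s m eps x0 t.+1 x' xt' z a c ->
    lazy_loop f p T s m eps x0 t x xt z a (2 + c).

(* LazyTensorSteps(x, T, s, m, eps) may return (z, a), using c oracle calls *)
Definition lazy_tensor_steps f p x T s m eps z a c : Prop :=
  lazy_loop f p T s m eps x 0 x x z a c.

Definition sigma p m (Lk : R) : R := 11 * p.+1%:R * Lk * m%:R.

Definition fd_step p s eps : R :=
  4 / (s * Num.sqrt n%:R) *
  (s ^+ p * eps_pow p eps /
     ((8 * p.+1%:R) ^+ p * 2 ^+ 7 * 3 `^ (p%:R^-1) * s `^ (p%:R^-1)))
  `^ (p.+1%:R^-1).

(* Finite-difference approximation at z of the p-th derivative *)
Definition fd_tensor f z (h : R) : form R n := fun hs =>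
  \sum_(i < n)
    otimes (fun gs => (nabla f (z + h *: basis_vec i) gs - nabla f z gs) / h)
           (basis_vec i) hs.

Definition next_L (a : outcome) (Lk : R) : R :=
  match a with halt => 2 * Lk | solution => Lk | success => Lk / 2 end.

(* The iteration k of the outer algorithm, with Lk the current estimate *)
Definition outer_step f p m eps z (Lk : R) z' (Lk' : R) (a : outcome) c :
    Prop :=
  let s := sigma p m Lk in
  lazy_tensor_steps f p z (fd_tensor f z (fd_step p s eps)) s m eps z' a c /\
  Lk' = next_L a Lk.

(* The sequences z, Lk, a, c describe an execution of the outer algorithm; they
   are unconstrained beyond the first k with |grad f (z k)| <= eps, where the
   algorithm stops. *)
Definition execution f p m eps z0 (L0 : R) (z : nat -> 'rV[R]_n)
    (Lk : nat -> R) (a : nat -> outcome) (c : nat -> nat) : Prop :=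
  [/\ z 0 = z0, Lk 0 = L0 &
      forall k : nat, (forall j, (j <= k)%N -> eps < enorm (grad f (z j))) ->
        outer_step f p m eps (z k) (Lk k) (z k.+1) (Lk k.+1) (a k) (c k)].

(* Oracle calls of the first K outer iterations: one for grad f (z k), n for the
   points z k + h e_i, and those of LazyTensorSteps. The test of the gradient
   at the final iterate is not an iteration and is not counted. *)
Definition oracle_calls (c : nat -> nat) (K : nat) : nat :=
  \sum_(k < K) (1 + n + c k).

Definition stops_at f eps (z : nat -> 'rV[R]_n) (K : nat) : Prop :=
  enorm (grad f (z K)) <= eps /\
  forall k, (k < K)%N -> eps < enorm (grad f (z k)).

End Algorithms.

Arguments fd_step {R} n p s eps.
Arguments oracle_calls n c K : clear implicits.

(* Main.v *)
Require Import Defs.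
From HB Require Import structures.
From mathcomp Require Import all_boot all_order all_algebra.
From mathcomp Require Import all_classical all_reals all_analysis.
From mathcomp Require Import ring lra zify.
Import Order.TTheory GRing.Theory Num.Theory.
Import numFieldNormedType.Exports.
Local Open Scope classical_set_scope.
Local Open Scope ring_scope.
Set Implicit Arguments.
Unset Strict Implicit.
Unset Printing Implicit Defensive.

(* A trial length L_k >= L never produces the outcome "halt". With sigma = 11
   (p+1) L_k m, let r_t be the length of the t-th inner step and s_t <= r_0 + ...
   + r_(t-1) the distance from x_0, at which the tensor was computed, to x_t. The
   tensor differs from the p-th derivative at x_t by at most L s_t + delta, delta
   being the finite-difference error. Taylor's formula then bounds the gradient at
   x_(t+1) by a multiple of sigma r_t^p plus (L s_t + delta) r_t^(p-1), and bounds
   f(x_t) - f(x_(t+1)) from below by a multiple of sigma r_t^(p+1) minus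
   (L s_t + delta) r_t^p. As L m is small compared with sigma, the power-mean
   inequality absorbs the terms in s_t into the sum of the r_t^(p+1) over at most
   m steps, and a gradient larger than eps forces this sum, hence the decrease of
   f, to grow linearly in t.

   So L_k stays below L_max = max(L_0, 2 L), each "success" decreases f by a fixed
   amount, and the number of "halt" outcomes exceeds that of successes by at most
   log_2 (L_max / L_0). For small eps this logarithm is absorbed by the main
   term. *)

Section EuclideanNorm.
Context {R : realType} {n : nat}.
Implicit Types (u v w : 'rV[R]_n) (a : R).

Lemma dotC u v : dot u v = dot v u.
Proof. by apply: eq_bigr => i _; rewrite mulrC. Qed.

Lemma dotDl u v w : dot (u + v) w = dot u w + dot v w.
Proof. by rewrite /dot -big_split; apply: eq_bigr => i _; rewrite mxE mulrDl. Qed.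

Lemma dotZl a u v : dot (a *: u) v = a * dot u v.
Proof. by rewrite /dot mulr_sumr; apply: eq_bigr => i _; rewrite mxE mulrA. Qed.

Lemma dotDr u v w : dot u (v + w) = dot u v + dot u w.
Proof. by rewrite dotC dotDl !(dotC u). Qed.

Lemma dotZr a u v : dot u (a *: v) = a * dot u v.
Proof. by rewrite dotC dotZl dotC. Qed.

Lemma dot_ge0 u : 0 <= dot u u.
Proof. by apply: sumr_ge0 => i _; rewrite -expr2 sqr_ge0. Qed.

Lemma enorm_ge0 u : 0 <= enorm u.
Proof. exact: sqrtr_ge0. Qed.

Lemma sqr_enorm u : enorm u ^+ 2 = dot u u.
Proof. by rewrite sqr_sqrtr ?dot_ge0. Qed.

Lemma enorm_eq0 u : (enorm u == 0) = (u == 0).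
Proof.
rewrite sqrtr_eq0 le_eqVlt ltNge dot_ge0 orbF psumr_eq0; last first.
  by move=> i _; rewrite -expr2 sqr_ge0.
apply/allP/eqP => [u0|-> i _]; last by rewrite mxE mul0r eqxx.
apply/rowP => i; rewrite mxE; have := u0 i (mem_index_enum i).
by rewrite /= mulf_eq0 orbb => /eqP.
Qed.

Lemma enorm0 : enorm (0 : 'rV[R]_n) = 0.
Proof. by apply/eqP; rewrite enorm_eq0. Qed.

Lemma enorm_gt0 u : (0 < enorm u) = (u != 0).
Proof. by rewrite lt_def enorm_ge0 enorm_eq0 andbT. Qed.

Lemma enormZ a u : enorm (a *: u) = `|a| * enorm u.
Proof.
by rewrite /enorm dotZl dotZr mulrA -expr2 sqrtrM ?sqr_ge0// sqrtr_sqr.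
Qed.

Lemma enormN u : enorm (- u) = enorm u.
Proof. by rewrite -scaleN1r enormZ normrN1 mul1r. Qed.

Lemma cauchy_schwarz u v : `|dot u v| <= enorm u * enorm v.
Proof.
have [->|v0] := eqVneq v 0.
  rewrite (_ : dot u 0 = 0) ?normr0 ?mulr_ge0 ?enorm_ge0//.
  by rewrite /dot big1// => i _; rewrite mxE mulr0.
have vv : 0 < dot v v by rewrite -sqr_enorm exprn_gt0// enorm_gt0.
rewrite -(@ler_pXn2r _ 2)// ?nnegrE ?mulr_ge0 ?enorm_ge0//.
rewrite exprMn !sqr_enorm real_normK ?num_real//.
have := dot_ge0 (dot v v *: u + (- dot u v) *: v).
rewrite !(dotDl, dotDr, dotZl, dotZr) (dotC v u) => h.
rewrite -subr_ge0 -(pmulr_rge0 _ vv); apply: le_trans h _.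
by rewrite le_eqVlt; apply/orP; left; apply/eqP; ring.
Qed.

Lemma enormD u v : enorm (u + v) <= enorm u + enorm v.
Proof.
rewrite -(@ler_pXn2r _ 2)// ?nnegrE ?addr_ge0 ?enorm_ge0//.
rewrite sqrrD !sqr_enorm dotDl !dotDr (dotC v u).
have := cauchy_schwarz u v; have := ler_norm (dot u v); lra.
Qed.

Lemma dot_basis u (i : 'I_n) : dot (basis_vec i) u = u 0 i.
Proof.
rewrite /dot (bigD1 i)//= big1 ?addr0 => [|j ji]; first by rewrite mxE !eqxx mul1r.
by rewrite mxE (negbTE ji) andbF mul0r.
Qed.

Lemma enorm_basis (i : 'I_n) : enorm (basis_vec i : 'rV[R]_n) = 1.
Proof. by rewrite /enorm dot_basis mxE !eqxx sqrtr1. Qed.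

Lemma coord_le_enorm u (i : 'I_n) : `|u 0 i| <= enorm u.
Proof. by rewrite -dot_basis (le_trans (cauchy_schwarz _ _))// enorm_basis mul1r. Qed.

Lemma sum_basis u : u = \sum_(i < n) u 0 i *: basis_vec i.
Proof. exact: row_sum_delta. Qed.

Lemma sum_norm_le_enorm u : \sum_(i < n) `|u 0 i| <= Num.sqrt n%:R * enorm u.
Proof.
pose v : 'rV[R]_n := \row_i `|u 0 i|; pose o : 'rV[R]_n := const_mx 1.
have -> : \sum_(i < n) `|u 0 i| = dot o v.
  by apply: eq_bigr => i _; rewrite !mxE mul1r.
have -> : enorm u = enorm v.
  congr Num.sqrt; apply: eq_bigr => i _.
  by rewrite !mxE -expr2 -normrM -expr2 ger0_norm ?sqr_ge0.
have <- : enorm o = Num.sqrt n%:R.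
  congr Num.sqrt; rewrite /dot (eq_bigr (fun=> 1)) ?sumr_const ?card_ord//.
  by move=> i _; rewrite !mxE mul1r.
exact: le_trans (ler_norm _) (cauchy_schwarz _ _).
Qed.

End EuclideanNorm.

Section Multilinear.
Context {R : realType} {n : nat}.
Implicit Types (T : Defs.form R n) (h u v w : 'rV[R]_n) (hs : seq 'rV[R]_n).

Definition multilinear q T := forall hs1 hs2 a u v,
  (size hs1 + size hs2).+1 = q ->
  T (hs1 ++ (a *: u + v) :: hs2) = a * T (hs1 ++ u :: hs2) + T (hs1 ++ v :: hs2).

Lemma multilinear_cons q T h :
  multilinear q.+1 T -> multilinear q (fun hs => T (h :: hs)).
Proof. by move=> Tl hs1 hs2 a u v sz; apply: (Tl (h :: hs1)); rewrite /= -sz addSn. Qed.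

Lemma multilinearB q T1 T2 : multilinear q T1 -> multilinear q T2 ->
  multilinear q (fun hs => T1 hs - T2 hs).
Proof. by move=> T1l T2l hs1 hs2 a u v sz; rewrite T1l// T2l//; ring. Qed.

Lemma multilinear_sum q (I : finType) (T : I -> Defs.form R n) :
  (forall i, multilinear q (T i)) -> multilinear q (fun hs => \sum_i T i hs).
Proof.
move=> Tl hs1 hs2 a u v sz; rewrite mulr_sumr -big_split/=.
by apply: eq_bigr => i _; exact: Tl.
Qed.

Lemma multilinear_otimes q T w : multilinear q T -> multilinear q.+1 (otimes T w).
Proof.
move=> Tl hs1 hs2 a u v; rewrite /otimes; case: (lastP hs2) => [|hs l] [sz].
  rewrite !cats1 !size_rcons !last_rcons /= -!cats1 !take_size_cat//.
  by rewrite dotDr dotZr; ring.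
rewrite -!rcons_cons -!rcons_cat !size_rcons !last_rcons /= -!cats1.
rewrite !take_size_cat// Tl; first by ring.
by rewrite -sz size_rcons addnS.
Qed.

Lemma multilinear_head T hs h : multilinear (size hs).+1 T ->
  T (h :: hs) = \sum_(i < n) h 0 i * T (basis_vec i :: hs).
Proof.
move=> Tl; have TD a u v : T (a *: u + v :: hs) = a * T (u :: hs) + T (v :: hs).
  exact: (Tl [::]).
have T0 : T (0 :: hs) = 0.
  have := TD 1 0 0; rewrite scaler0 addr0 mul1r => /eqP.
  by rewrite -subr_eq subrr => /eqP.
rewrite {1}[h]sum_basis.
elim: (index_enum _) => [|i s IH]; first by rewrite !big_nil.
by rewrite !big_cons TD IH.
Qed.

Lemma multilinear_bounded q T : multilinear q T ->
  exists2 B, 0 <= B & forall hs, size hs = q ->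
    `|T hs| <= B * \prod_(h <- hs) enorm h.
Proof.
elim: q T => [|q IH] T Tl.
  by exists `|T [::]| => // -[]//= _; rewrite big_nil mulr1.
have /choice[B HB] i : exists B, 0 <= B /\ forall hs, size hs = q ->
    `|T (basis_vec i :: hs)| <= B * \prod_(h <- hs) enorm h.
  by have [B B0 HB] := IH _ (multilinear_cons (basis_vec i) Tl); exists B.
exists (\sum_i B i); first by apply: sumr_ge0 => i _; case: (HB i).
case=> [//|h hs] [sz]; rewrite big_cons.
rewrite multilinear_head ?sz// (le_trans (ler_norm_sum _ _ _))// mulr_suml.
apply: ler_sum => i _; rewrite normrM mulrCA ler_pM ?coord_le_enorm//.
by have [_] := HB i; apply.
Qed.

Lemma multilinear_scale T hs (c : 'rV[R]_n -> R) (g : 'rV[R]_n -> 'rV[R]_n) :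
  multilinear (size hs) T ->
  T [seq c h *: g h | h <- hs] = (\prod_(h <- hs) c h) * T [seq g h | h <- hs].
Proof.
elim: hs T => [|h hs IH] T Tl; first by rewrite big_nil mul1r.
rewrite /= big_cons (IH _ (multilinear_cons _ Tl)).
have Tl' : multilinear (size [seq g h | h <- hs]).+1 T by rewrite size_map.
rewrite (multilinear_head _ Tl') [in RHS](multilinear_head _ Tl') !mulr_sumr.
by apply: eq_bigr => i _; rewrite !mxE; ring.
Qed.

Lemma le_form_norm q T hs : multilinear q T -> size hs = q ->
  `|T hs| <= form_norm q T * \prod_(h <- hs) enorm h.
Proof.
move=> Tl sz; have [B B0 HB] := multilinear_bounded Tl.
pose g (h : 'rV[R]_n) := (enorm h)^-1 *: h.
have -> : hs = [seq enorm h *: g h | h <- hs].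
  rewrite -[LHS]map_id; apply: eq_map => h; rewrite /g scalerA.
  have [->|h0] := eqVneq h 0; first by rewrite scaler0.
  by rewrite divff ?scale1r// enorm_eq0.
rewrite multilinear_scale ?sz// big_map normrM mulrC.
have -> : \prod_(h <- hs) enorm (enorm h *: g h) = \prod_(h <- hs) enorm h.
  apply: eq_bigr => h _; rewrite /g scalerA.
  have [->|h0] := eqVneq h 0; first by rewrite scaler0.
  by rewrite divff ?scale1r// enorm_eq0.
have hs0 : 0 <= \prod_(h <- hs) enorm h.
  by apply: prodr_ge0 => h _; exact: enorm_ge0.
rewrite (ger0_norm hs0); apply: ler_wpM2r => //.
apply: ub_le_sup; last first.
  exists [seq g h | h <- hs]; split => //; first by rewrite size_map.
  move=> _ /mapP[h _ ->]; rewrite /g enormZ ger0_norm ?invr_ge0 ?enorm_ge0//.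
  have [->|h0] := eqVneq h 0; first by rewrite enorm0 mulr0.
  by rewrite mulVf// enorm_eq0.
exists B => _ [hs' [sz' le1 ->]]; apply: (le_trans (HB _ sz')).
rewrite ler_piMr//; elim: hs' {sz'} le1 => [|h hs' IH] le1; first by rewrite big_nil.
rewrite big_cons mulr_ile1 ?enorm_ge0 ?prodr_ge0//.
- by move=> k _; exact: enorm_ge0.
- by apply: le1; rewrite mem_head.
- by apply: IH => k kin; apply: le1; rewrite inE kin orbT.
Qed.

End Multilinear.

Section OneVariable.
Context {R : realType}.
Implicit Types (f g df dg : R -> R) (s : R).

Lemma mvt f df a b : a < b -> (forall s, is_derive s 1 f (df s)) ->
  exists2 c, a < c < b & f b - f a = df c * (b - a).
Proof.
move=> ab fdf; have [|c cab ->] := @MVT R f df a b ab (fun s _ => fdf s).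
  apply: derivable_within_continuous => s _.
  by have [] := fdf s.
by exists c => //; move: cab; rewrite in_itv.
Qed.

Lemma le_of_derive_le f df g dg b :
  (forall s, is_derive s 1 f (df s)) -> (forall s, is_derive s 1 g (dg s)) ->
  f 0 = g 0 -> (forall s, 0 <= s <= b -> df s <= dg s) ->
  forall s, 0 <= s <= b -> f s <= g s.
Proof.
move=> fdf gdg fg0 dle s /andP[]; rewrite le_eqVlt => /predU1P[<-|s0] sb.
  by rewrite fg0.
have [c /andP[c0 cs]] := @mvt (g - f) (dg - df) _ _ s0 (fun s => is_deriveB _ _).
rewrite !fctE fg0 subrr !subr0 => e.
rewrite -subr_ge0 e mulr_ge0 ?(ltW s0)// subr_ge0 dle// (ltW c0)/=.
exact: le_trans (ltW cs) sb.
Qed.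

Lemma is_derive_taylor_term (a : R) i s :
  is_derive s 1 (fun s => s ^+ i.+1 / i.+1`!%:R * a) (s ^+ i / i`!%:R * a).
Proof.
have -> : (fun s => s ^+ i.+1 / i.+1`!%:R * a) = (a / i.+1`!%:R) *: (id ^+ i.+1).
  by apply/funext => t; rewrite !fctE /GRing.scale/=; ring.
apply: is_derive_eq; rewrite /GRing.scale/= mulr1 factS natrM.
by field; rewrite !pnatr_eq0 -lt0n fact_gt0 addrC natr1 pnatr_eq0.
Qed.

Lemma is_derive_taylor (a : nat -> R) q s :
  is_derive s 1 (fun s => \sum_(i < q.+1) s ^+ i / i`!%:R * a i)
    (\sum_(i < q) s ^+ i / i`!%:R * a i.+1).
Proof.
elim: q => [|q IH].
  rewrite big_ord0.
  under eq_fun do rewrite big_ord_recl big_ord0 expr0.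
  exact: is_derive_cst.
under eq_fun do rewrite big_ord_recr.
rewrite big_ord_recr /=.
exact: is_deriveD IH (is_derive_taylor_term _ _ _).
Qed.

End OneVariable.

Section Derivatives.
Context {R : realType} {n : nat}.
Implicit Types (f g : 'rV[R]_n -> R) (x y u v w h : 'rV[R]_n).
Implicit Types (hs : seq 'rV[R]_n) (q : nat) (a s e C : R).

Lemma is_derive_line g x v s : differentiable g (x + s *: v) ->
  is_derive s 1 (fun s => g (x + s *: v)) ('d g (x + s *: v) v).
Proof.
move=> dg.
have dl : is_diff s (fun s => x + s *: v) (fun s => s *: v).
  have -> : (fun s => s *: v) = (0 : R -> _) + ( *:%R^~ v).
    by apply/funext => t; rewrite !fctE add0r.
  exact: (is_diffD (is_diff_cst x s) (is_diff_scalel s v)).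
have dc := is_diff_comp dl (differentiableP dg).
apply: DeriveDef; first by apply: diff_derivable; exact: ex_diff.
rewrite deriveE; last exact: ex_diff.
by rewrite diff_val /= scale1r.
Qed.

Lemma diff_comb f g x a h : differentiable f x -> differentiable g x ->
  'd (fun y => a * f y + g y) x h = a * 'd f x h + 'd g x h.
Proof.
move=> df dg.
have := @diff_val _ _ _ _ _ _ _
  (is_diffD (is_diffZ a (differentiableP df)) (differentiableP dg)).
by move=> /(congr1 (@^~ h)).
Qed.

Lemma differentiable_comb f g x a : differentiable f x -> differentiable g x ->
  differentiable (fun y => a * f y + g y) x.
Proof. by move=> df dg; apply: differentiableD => //; exact: differentiableZ. Qed.

Lemma nabla_comb q f g a x hs :
  times_differentiable q f -> times_differentiable q g -> (size hs <= q)%N ->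
  nabla (fun y => a * f y + g y) x hs = a * nabla f x hs + nabla g x hs.
Proof.
elim: q f g hs => [|q IH] f g [|h hs]// [df tf] [dg tg] sz.
rewrite -(IH _ _ _ (tf h) (tg h) sz) /=; congr (nabla _ x hs).
by apply/funext => y; exact: (diff_comb _ _ (df y) (dg y)).
Qed.

Lemma times_differentiable_le q1 q2 f : (q1 <= q2)%N ->
  times_differentiable q2 f -> times_differentiable q1 f.
Proof.
elim: q1 q2 f => // q1 IH [//|q2] f /= le [df tf].
by split=> // h; exact: IH (tf h).
Qed.

Lemma nabla_cat f x hs1 hs2 :
  nabla f x (hs1 ++ hs2) = nabla (fun y => nabla f y hs1) x hs2.
Proof. by elim: hs1 f => //= h hs1 IH f; rewrite IH. Qed.

Lemma times_differentiable_nabla q f hs :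
  times_differentiable (size hs + q) f ->
  times_differentiable q (fun x => nabla f x hs).
Proof. by elim: hs f => //= h hs IH f [_ tf]; exact: IH (tf h). Qed.

Lemma multilinear_nabla q f x :
  times_differentiable q f -> multilinear q (nabla f x).
Proof.
move=> tf hs1 hs2 a u v sz; rewrite !nabla_cat /=.
have : times_differentiable (size hs2).+1 (fun x => nabla f x hs1).
  by apply: times_differentiable_nabla; rewrite addnS sz.
move: (fun x => nabla f x hs1) => g /= [_ tg].
by under eq_fun do rewrite linearP; rewrite (nabla_comb _ _ (tg u) (tg v)).
Qed.

Lemma differentiable_expansion g x e : differentiable g x -> 0 < e ->
  exists2 d, 0 < d & forall k, `|k| < d ->
    `|g (x + k) - g x - 'd g x k| <= e * `|k|.
Proof.
move=> /diff_locallyP[_ /eqaddoP /(_ e)] H /H /nbhs_ballP[d d0 Hd].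
exists d => // k kd; have := Hd k.
rewrite /= -ball_normE /= sub0r normrN => /(_ kd).
by rewrite !fctE opprD addrA (addrC k).
Qed.

Definition second_difference f x u v s : R :=
  f (x + s *: u + s *: v) - f (x + s *: u) - (f (x + s *: v) - f x).

Lemma second_differenceC f x u v s :
  second_difference f x u v s = second_difference f x v u s.
Proof.
rewrite /second_difference (addrAC x (s *: u)).
by move: (f _) (f (_ + s *: u)) (f (_ + s *: v)) (f x) => A B C D; ring.
Qed.

Lemma second_difference_approx f g x u v e :
  (forall y, differentiable f y) -> (forall y, 'd f y u = g y) ->
  differentiable g x -> 0 < e ->
  exists2 d, 0 < d & forall s, 0 < s < d ->
    `|second_difference f x u v s - s ^+ 2 * 'd g x v| <= e * s ^+ 2.
Proof.
move=> df fg dfu e0.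
pose c := 2 * `|u| + `|v| + 1.
have u0 := normr_ge0 u; have v0 := normr_ge0 v.
have c0 : 0 < c by rewrite /c; clear -u0 v0; lra.
have cu : `|u| <= c by rewrite /c; clear -u0 v0; lra.
have cuv : `|u| + `|v| <= c by rewrite /c; clear -u0 v0; lra.
have cuuv : `|u| + `|v| + `|u| <= c by rewrite /c; clear -u0 v0; lra.
have [d d0 Hd] := differentiable_expansion dfu (divr_gt0 e0 c0).
exists (d / c); first by rewrite divr_gt0.
move=> s /andP[s0 sd]; rewrite ltr_pdivlMr// in sd.
have Dl y (t : R) :
    is_derive t (1 : R) (fun t : R => f (y + t *: u)) ('d f (y + t *: u) u).
  exact/is_derive_line.
have [t /andP[t0 ts]] := mvt s0 (fun t => is_deriveB (Dl (x + s *: v) t) (Dl x t)).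
rewrite !fctE !subr0 !scale0r !addr0 => E.
have -> : second_difference f x u v s =
    (g (x + (s *: v + t *: u)) - g (x + t *: u)) * s.
  rewrite addrA -!fg -E /second_difference (addrAC x (s *: u)).
  by move: (f _) (f (_ + s *: u)) (f (_ + s *: v)) (f x) => A B C D; ring.
have H1 : `|s *: v + t *: u| <= s * (`|u| + `|v|).
  rewrite (le_trans (ler_normD _ _))// !normrZ !gtr0_norm// mulrDr addrC lerD2r.
  by rewrite ler_wpM2r// ltW.
have H2 : `|t *: u| <= s * `|u|.
  by rewrite normrZ gtr0_norm// ler_wpM2r// ltW.
have k1 : `|s *: v + t *: u| < d.
  apply: le_lt_trans H1 (le_lt_trans _ sd).
  by rewrite ler_wpM2l// ltW.
have k2 : `|t *: u| < d.
  apply: le_lt_trans H2 (le_lt_trans _ sd).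
  by rewrite ler_wpM2l// ltW.
have := Hd _ k1; have := Hd _ k2.
have -> : 'd g x (s *: v + t *: u) = s * 'd g x v + t * 'd g x u.
  by rewrite linearD !linearZ.
have -> : 'd g x (t *: u) = t * 'd g x u by rewrite linearZ.
move: ('d g x v) ('d g x u) (g (x + (_ + _))) (g (x + _)) => dv du A B B2 B1.
have -> : (A - B) * s - s ^+ 2 * dv =
  s * ((A - g x - (s * dv + t * du)) - (B - g x - t * du)) by ring.
rewrite normrM gtr0_norm// expr2 mulrCA ler_wpM2l ?(ltW s0)//.
apply: (le_trans (ler_normB _ _)); apply: le_trans (lerD B1 B2) _.
rewrite -mulrDr -mulrA ler_wpM2l ?(ltW e0)// ler_pdivrMl//.
apply: le_trans (lerD H1 H2) _; by rewrite -mulrDr mulrC ler_wpM2r// ltW.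
Qed.

Lemma diff_diffC f x u v : (forall y, differentiable f y) ->
  differentiable (fun y => 'd f y u) x -> differentiable (fun y => 'd f y v) x ->
  'd (fun y => 'd f y u) x v = 'd (fun y => 'd f y v) x u.
Proof.
move=> df du dv; apply/eqP; rewrite -subr_eq0 -normr_le0.
apply/ler_addgt0Pl => e e0; rewrite addr0.
have e2 : 0 < e / 2 by rewrite divr_gt0.
have [d1 d10 H1] := second_difference_approx v df (fun=> erefl) du e2.
have [d2 d20 H2] := second_difference_approx u df (fun=> erefl) dv e2.
pose s := Num.min d1 d2 / 2.
have m0 : 0 < Num.min d1 d2 by rewrite lt_min d10.
have s0 : 0 < s by rewrite divr_gt0.
have sm : s < Num.min d1 d2 by rewrite /s ltr_pdivrMr// ltr_pMr// ltr1n.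
move: (sm); rewrite lt_min => /andP[s1 s2].
have := H1 s; have := H2 s; rewrite s0 s1 s2 second_differenceC.
move=> /(_ isT) A /(_ isT) B.
rewrite -(@ler_pM2l _ (s ^+ 2)) ?exprn_gt0//.
have E (D a b : R) : `|D - s ^+ 2 * b| <= e / 2 * s ^+ 2 ->
    `|D - s ^+ 2 * a| <= e / 2 * s ^+ 2 -> s ^+ 2 * `|a - b| <= s ^+ 2 * e.
  move=> hb ha; rewrite -[X in X * `|_|]gtr0_norm ?exprn_gt0// -normrM.
  have -> : s ^+ 2 * (a - b) = (D - s ^+ 2 * b) - (D - s ^+ 2 * a) by ring.
  apply: (le_trans (ler_normB _ _)); apply: le_trans (lerD hb ha) _.
  by rewrite le_eqVlt; apply/orP; left; apply/eqP; field.
exact: E A B.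
Qed.

Lemma nabla_swap q f x u v hs : times_differentiable q.+2 f ->
  nabla f x (u :: v :: hs) = nabla f x (v :: u :: hs).
Proof.
move=> /= [df tf]; congr (nabla _ x hs); apply/funext => y.
by apply: diff_diffC => //; have [] := tf u; have [] := tf v.
Qed.

Lemma nabla_nseq_move q f x w v i j : times_differentiable q f -> (i + j < q)%N ->
  nabla f x (nseq i w ++ v :: nseq j w) = nabla f x (v :: nseq (i + j) w).
Proof.
elim: i q f => // i IH [//|[|q]] f tf; rewrite addSn !ltnS// => ij.
rewrite -(nabla_swap _ _ _ _ tf); exact: (IH q.+1 _ (tf.2 w)).
Qed.

Lemma taylor_bound q g x h C : times_differentiable q g ->
  (forall s, 0 <= s <= 1 ->
    `|nabla g (x + s *: h) (nseq q h) - nabla g x (nseq q h)| <= C * s) ->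
  forall s, 0 <= s <= 1 ->
    `|g (x + s *: h) - \sum_(i < q.+1) s ^+ i / i`!%:R * nabla g x (nseq i h)|
      <= C * (s ^+ q.+1 / q.+1`!%:R).
Proof.
elim: q g => [|q IH] g.
  move=> _ H s s01; have := H s s01.
  by rewrite big_ord_recl big_ord0 /= addr0 expr0 divr1 mul1r expr1 divr1.
move=> [dg tg] H s s01; rewrite ler_norml.
have {}IH := IH _ (tg h) H.
pose r s := g (x + s *: h) - \sum_(i < q.+2) s ^+ i / i`!%:R * nabla g x (nseq i h).
pose dr (s : R) : R := 'd g (x + s *: h) h -
  \sum_(i < q.+1) s ^+ i / i`!%:R * nabla (fun y => 'd g y h) x (nseq i h).
have Dr (t : R) : is_derive t (1 : R) r (dr t).
  apply: is_deriveB; first exact/is_derive_line.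
  exact: (is_derive_taylor (fun i => nabla g x (nseq i h))).
pose b s := C * (s ^+ q.+2 / q.+2`!%:R).
pose db s := C * (s ^+ q.+1 / q.+1`!%:R).
have Db (t : R) : is_derive t (1 : R) b (db t).
  rewrite /b /db; under eq_fun do rewrite mulrC.
  by rewrite mulrC; exact: is_derive_taylor_term.
have b0 : b 0 = 0 by rewrite /b expr0n /= mul0r mulr0.
have r0 : r 0 = 0.
  rewrite /r big_ord_recl big1 ?addr0 => [|i _]; last by rewrite expr0n !mul0r.
  by rewrite expr0 divr1 mul1r scale0r addr0 subrr.
apply/andP; split.
- rewrite -/(b s) lerNl -/(r s).
  apply: (@le_of_derive_le _ (fun s => - r s) (fun s => - dr s) b db 1
    (fun t => is_deriveN (Dr t)) Db) => //.
    by rewrite r0 b0 oppr0.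
  by move=> t t01; have := IH t t01; rewrite ler_norml => /andP[] + _; rewrite lerNl.
- apply: (@le_of_derive_le _ r dr b db 1 Dr Db) => //; first by rewrite r0 b0.
  by move=> t t01; have := IH t t01; rewrite ler_norml => /andP[].
Qed.

End Derivatives.

Section Gradients.
Context {R : realType} {n : nat}.
Implicit Types (f g : 'rV[R]_n -> R) (x y u v w : 'rV[R]_n) (T : Defs.form R n).
Implicit Types (s C : R) (p q : nat).

Lemma dot_grad f x v : dot (grad f x) v = 'd f x v.
Proof.
rewrite [in RHS](sum_basis v) linear_sum; apply: eq_bigr => i _.
by rewrite mxE linearZ mulrC.
Qed.

Lemma diff_le_enorm_grad f x v : `|'d f x v| <= enorm (grad f x) * enorm v.
Proof. by rewrite -dot_grad cauchy_schwarz. Qed.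

Lemma enorm_grad_le f x C : 0 <= C -> (forall v, `|'d f x v| <= C * enorm v) ->
  enorm (grad f x) <= C.
Proof.
move=> C0 H; have [->|g0] := eqVneq (grad f x) 0; first by rewrite enorm0.
have := H (grad f x); rewrite -dot_grad -sqr_enorm ger0_norm ?sqr_ge0//.
by rewrite expr2 ler_pM2r// enorm_gt0.
Qed.

Lemma is_diff_sum_seq (I : eqType) (r : seq I) (F dF : I -> 'rV[R]_n -> R) y :
  (forall i, i \in r -> is_diff y (F i) (dF i)) ->
  is_diff y (fun z => \sum_(i <- r) F i z) (fun v => \sum_(i <- r) dF i v).
Proof.
elim: r => [|i r IH] H.
  under eq_fun do rewrite big_nil.
  under [X in is_diff _ _ X]eq_fun do rewrite big_nil.
  exact: is_diff_cst.
under eq_fun do rewrite big_cons.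
under [X in is_diff _ _ X]eq_fun do rewrite big_cons.
apply: is_diffD (H i (mem_head _ _)) (IH _) => j jr.
by apply: H; rewrite inE jr orbT.
Qed.

Lemma is_diff_coord x y (i : 'I_n) :
  is_diff y (fun z => (z - x) 0 i) (fun v => v 0 i).
Proof.
have linc : linear (fun v : 'rV[R]_n => v 0 i : R) by move=> a u v; rewrite !mxE.
pose cM := GRing.isLinear.Build _ _ _ _ _ linc.
pose c : {linear 'rV[R]_n -> R} := HB.pack (fun v : 'rV[R]_n => v 0 i : R) cM.
have cc : continuous c by exact: coord_continuous.
have dc : is_diff y c c.
  by apply: DiffDef; [exact: linear_differentiable|exact: diff_lin].
have -> : (fun z => (z - x) 0 i) = (c : _ -> R) + cst (- x 0 i).
  by apply/funext => z; rewrite !fctE !mxE.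
apply: is_diff_eq (is_diffD dc (is_diff_cst _ _)) _.
by apply/funext => v; rewrite !fctE addr0.
Qed.

Lemma is_diff_diagonal q T x y : multilinear q T ->
  is_diff y (fun z => T (nseq q (z - x)))
    (fun v => \sum_(j < q) T (nseq j (y - x) ++ v :: nseq (q - j.+1) (y - x))).
Proof.
elim: q T => [|q IH] T Tl.
  under [X in is_diff _ _ X]eq_fun do rewrite big_ord0.
  exact: (is_diff_cst (T [::]) y).
have TE hs h : size hs = q -> T (h :: hs) = \sum_i h 0 i * T (basis_vec i :: hs).
  by move=> sz; apply: multilinear_head; rewrite sz.
under eq_fun do rewrite /= TE ?size_nseq//.
have D i := is_diffM (is_diff_coord x y i) (IH _ (multilinear_cons (basis_vec i) Tl)).
apply: is_diff_eq; first exact: (is_diff_sum_seq (fun i _ => D i)).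
apply/funext => v.
transitivity (\sum_i ((y - x) 0 i * (\sum_(j < q) T (basis_vec i ::
    nseq j (y - x) ++ v :: nseq (q - j.+1) (y - x)))
    + T (basis_vec i :: nseq q (y - x)) * v 0 i)); first exact: eq_bigr.
rewrite big_split/= addrC big_ord_recl /=.
congr (_ + _).
  by rewrite subn1 /= TE ?size_nseq//; apply: eq_bigr => i _; rewrite mulrC.
under eq_bigr do rewrite mulr_sumr.
rewrite exchange_big; apply: eq_bigr => j _ /=.
rewrite subSS TE // size_cat /= !size_nseq addnS -addSn.
by rewrite subnKC ?ltn_ord.
Qed.

Lemma is_diff_sqr_enorm x y :
  is_diff y (fun z => enorm (z - x) ^+ 2) (fun v => 2 * dot (y - x) v).
Proof.
under eq_fun do rewrite sqr_enorm.
have D i := is_diffM (is_diff_coord x y i) (is_diff_coord x y i).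
apply: is_diff_eq; first exact: (is_diff_sum_seq (fun i _ => D i)).
apply/funext => v; rewrite /dot mulr_sumr; apply: eq_bigr => i _.
by rewrite !fctE /GRing.scale/=; ring.
Qed.

Lemma enorm_le_norm v : enorm v <= Num.sqrt n%:R * `|v|.
Proof.
rewrite -(@ler_pXn2r _ 2)// ?nnegrE ?mulr_ge0 ?enorm_ge0 ?sqrtr_ge0//.
rewrite sqr_enorm exprMn sqr_sqrtr// /dot mulr_natl -[X in _ *+ X]card_ord.
rewrite -sumr_const; apply: ler_sum => i _; rewrite -expr2 -real_normK ?num_real//.
rewrite ler_pXn2r ?nnegrE//.
by rewrite [leRHS]mx_normrE (le_bigmax _ (fun i => `|v i.1 i.2|) (0, i)).
Qed.

Lemma is_diff_enorm_pow p x y :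
  is_diff y (fun z => enorm (z - x) ^+ p.+2)
    (fun v => p.+2%:R * enorm (y - x) ^+ p * dot (y - x) v).
Proof.
have [yx|yx] := eqVneq (y - x) 0; last first.
  have d0 : 0 < enorm (y - x) ^+ 2 by rewrite exprn_gt0// enorm_gt0.
  have ds : is_diff (enorm (y - x) ^+ 2) Num.sqrt
      (fun v : R => v * (2 * enorm (y - x))^-1).
    have [ex de] := is_derive1_sqrt d0.
    have exd : differentiable Num.sqrt (enorm (y - x) ^+ 2) by apply/derivable1_diffP.
    apply: DiffDef => //; apply/funext => v.
    rewrite diff1E// derive1E de sqrtr_sqr ger0_norm ?enorm_ge0//.
  have -> : (fun z => enorm (z - x) ^+ p.+2) =
      (Num.sqrt \o (fun z => enorm (z - x) ^+ 2)) ^+ p.+2.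
    by apply/funext => z; rewrite !fctE /= sqrtr_sqr ger0_norm ?enorm_ge0.
  have D := is_diffX p.+1 (is_diff_comp (is_diff_sqr_enorm x y) ds).
  apply: is_diff_eq D _; apply/funext => v.
  rewrite !fctE /GRing.scale/= sqrtr_sqr ger0_norm ?enorm_ge0// exprSr.
  have : enorm (y - x) != 0 by rewrite enorm_eq0.
  by move: (enorm (y - x)) (dot _ _) => r d r0; field.
have -> : y = x by apply/eqP; rewrite -subr_eq0 yx.
have -> : (fun v => p.+2%:R * enorm (x - x) ^+ p * dot (x - x) v) = \0.
  apply/funext => v; rewrite subrr (_ : dot 0 v = 0) ?mulr0//.
  by rewrite -(scale0r 0) dotZl mul0r.
pose F (z : 'rV[R]_n) : R^o := enorm (z - x) ^+ p.+2.
have E : F \o shift x = cst (F x) + (\0 : 'rV[R]_n -> R^o) +o_ (0 : 'rV[R]_n) id.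
  apply/eqaddoP => e e0; apply/nbhs_ballP.
  pose c : R := Num.sqrt n%:R ^+ p.+2 + 1.
  have c0 : 0 < c by rewrite /c ltr_wpDl// exprn_ge0// sqrtr_ge0.
  exists (Num.min 1 (e / c)); first by rewrite /= lt_min ltr01 divr_gt0.
  move=> k; rewrite -ball_normE /= sub0r normrN lt_min => /andP[k1 ke].
  rewrite !fctE /F /= subrr enorm0 expr0n /= !addr0 subr0 addrK.
  rewrite ger0_norm ?exprn_ge0 ?enorm_ge0//.
  have H := enorm_le_norm k.
  apply: (@le_trans _ _ ((Num.sqrt n%:R * `|k|) ^+ p.+2)).
    by rewrite lerXn2r ?nnegrE ?enorm_ge0// mulr_ge0// sqrtr_ge0.
  rewrite exprMn.
  apply: (@le_trans _ _ (c * (`|k| * `|k|))).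
    rewrite ler_pM ?exprn_ge0 ?sqrtr_ge0//; first by rewrite /c lerDl.
    rewrite -expr2 -[leRHS]mulr1 exprS exprS expr2 mulrA.
    by rewrite ler_wpM2l ?mulr_ge0// exprn_ile1// ltW.
  rewrite mulrA ler_wpM2r// mulrC -ler_pdivlMr//; exact: ltW.
have dE := @diff_unique R 'rV[R]_n R^o F \0 x (@cst_continuous _ _ 0) E.
apply: DiffDef => //.
by apply/diff_locallyP; rewrite dE; split; [exact: cst_continuous|].
Qed.

Lemma is_diff_mulr c f df y : is_diff y f df ->
  is_diff y (fun z => c * f z) (fun v => c * df v).
Proof. exact: is_diffZ. Qed.

Lemma is_diff_model f p T s x y : times_differentiable p f -> multilinear p.+1 T ->
  is_diff y (model f p.+1 T s x) (fun v =>
    \sum_(1 <= i < p.+1) i`!%:R^-1 * (\sum_(j < i)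
        nabla f x (nseq j (y - x) ++ v :: nseq (i - j.+1) (y - x)))
    + p.+1`!%:R^-1 * (\sum_(j < p.+1)
        T (nseq j (y - x) ++ v :: nseq (p.+1 - j.+1) (y - x)))
    + s / p.+2`!%:R * (p.+2%:R * enorm (y - x) ^+ p * dot (y - x) v)).
Proof.
move=> tf Tl.
have le_p i : i \in index_iota 1 p.+1 -> (i <= p)%N.
  by rewrite mem_index_iota ltnS => /andP[].
have D1 i (ip : i \in index_iota 1 p.+1) := is_diff_mulr i`!%:R^-1 (is_diff_diagonal x y
  (multilinear_nabla x (times_differentiable_le (le_p i ip) tf))).
have D2 := is_diff_mulr p.+1`!%:R^-1 (is_diff_diagonal x y Tl).
have D3 := is_diff_mulr (s / p.+2`!%:R) (is_diff_enorm_pow p x y).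
have D0 := is_diff_cst (f x) y.
have := is_diffD (is_diffD (is_diffD D0 (is_diff_sum_seq D1)) D2) D3.
rewrite (_ : _ + _ = model f p.+1 T s x); last first.
  apply/funext => z; rewrite !fctE /model /pow_eval; congr (_ + _ + _ + _).
    by apply: eq_bigr => i _; rewrite mulrC.
  by rewrite mulrC.
move=> D; apply: is_diff_eq D _; apply/funext => v; rewrite !fctE; congr (_ + _ + _).
exact: add0r.
Qed.

Definition lipschitz_derivative q g (L : R) := forall x y hs, size hs = q ->
  `|nabla g x hs - nabla g y hs| <= L * enorm (x - y) * \prod_(h <- hs) enorm h.

Lemma prod_enorm_nseq k w : \prod_(h <- nseq k w) enorm h = enorm w ^+ k.
Proof.
by elim: k => [|k IH]; rewrite ?big_nil// big_cons IH exprS.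
Qed.

Lemma taylor_lipschitz q g x y L :
  times_differentiable q g -> lipschitz_derivative q g L ->
  `|g y - \sum_(i < q.+1) i`!%:R^-1 * nabla g x (nseq i (y - x))|
    <= L * enorm (y - x) ^+ q.+1 / q.+1`!%:R.
Proof.
move=> tg lg; set w := y - x.
have H s : 0 <= s <= 1 -> `|nabla g (x + s *: w) (nseq q w) - nabla g x (nseq q w)| <=
    L * enorm w ^+ q.+1 * s.
  move=> /andP[s0 _]; apply: le_trans (lg _ _ _ (size_nseq _ _)) _.
  rewrite addrAC subrr add0r enormZ ger0_norm// prod_enorm_nseq exprS.
  by rewrite le_eqVlt; apply/orP; left; apply/eqP; ring.
have := taylor_bound tg H (s := 1); rewrite ler01 lexx => /(_ isT).
rewrite scale1r (_ : x + w = y) ?[x + w]addrC ?subrK// expr1n mul1r.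
by under eq_bigr do rewrite expr1n mul1r.
Qed.

Lemma gradient_split (df dM S N D d i0 i1 i2 c1 c2 rp s a b c e : R) :
  `|df - (S + i0 * N)| <= a -> `|dM| <= b -> `|D| <= c -> `|d| <= e ->
  dM = S + i1 * (D + c1 * N) + s * i2 * (c2 * rp * d) ->
  i0 = c1 * i1 -> i1 = c2 * i2 -> 0 <= i1 -> 0 <= s -> 0 <= rp ->
  `|df| <= a + b + i1 * c + s * i1 * (rp * e).
Proof.
move=> Ha Hb Hc He E E0 E1 i1_ge0 s0 rp0.
have -> : df = (df - (S + i0 * N)) + dM - i1 * D - s * i1 * (rp * d).
  by rewrite E E0 E1; ring.
apply: le_trans (ler_normB _ _) (lerD _ _).
  apply: le_trans (ler_normB _ _) (lerD _ _).
    exact: le_trans (ler_normD _ _) (lerD Ha Hb).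
  by rewrite normrM ger0_norm// ler_wpM2l.
rewrite !normrM (ger0_norm s0) (ger0_norm i1_ge0) (ger0_norm rp0).
by rewrite !ler_wpM2l ?mulr_ge0.
Qed.

Section ModelError.
Variables (f : 'rV[R]_n -> R) (p : nat) (T : Defs.form R n) (L B s : R).
Variables (x y : 'rV[R]_n).
Hypothesis tf : times_differentiable p.+1 f.
Hypothesis lf : lipschitz_derivative p.+1 f L.
Hypothesis Tl : multilinear p.+1 T.
Hypothesis TB : forall hs, size hs = p.+1 ->
  `|T hs - nabla f x hs| <= B * \prod_(h <- hs) enorm h.
Let w := y - x.
Let r := enorm w.

Lemma le_model : f y <= model f p.+1 T s x y
  + (L - s) * r ^+ p.+2 / p.+2`!%:R + B * r ^+ p.+1 / p.+1`!%:R.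
Proof.
have E : \sum_(i < p.+2) i`!%:R^-1 * nabla f x (nseq i w) =
    f x + \sum_(1 <= i < p.+1) nabla f x (nseq i w) / i`!%:R
    + nabla f x (nseq p.+1 w) / p.+1`!%:R.
  rewrite big_ord_recr big_ord_recl big_add1 big_mkord; congr (_ + _ + _).
  - by rewrite invr1 mul1r.
  - by apply: eq_bigr => i _; rewrite mulrC.
  - by rewrite mulrC.
have := taylor_lipschitz x y tf lf; rewrite -/w -/r ler_norml E => /andP[_].
have := TB (size_nseq p.+1 w); rewrite prod_enorm_nseq -/r ler_norml => /andP[+ _].
rewrite /model /pow_eval -/w -/r.
move: (\sum_(1 <= i < _) _) (T _) (nabla f x _) => S t t'.
have F1 : 0 <= p.+1`!%:R^-1 :> R by rewrite invr_ge0.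
move: (p.+1`!%:R^-1 : R) (p.+2`!%:R^-1 : R) F1 => i1 i2 F1 H1 H2.
have : i1 * (- (B * r ^+ p.+1)) <= i1 * (t - t') by rewrite ler_wpM2l.
move: (r ^+ p.+1) (r ^+ p.+2) (f y) (f x) H2 => r1 r2 fy fx.
lra.
Qed.

Lemma enorm_grad_le_model : 0 <= L -> 0 <= B -> 0 <= s ->
  enorm (grad f y) <= enorm (grad (model f p.+1 T s x) y)
  + (L + s) * r ^+ p.+1 / p.+1`!%:R + B * r ^+ p / p`!%:R.
Proof.
move=> L0 B0 s0; have tp := times_differentiable_le (leqnSn p) tf.
apply: enorm_grad_le => [|v].
  by rewrite !addr_ge0 ?enorm_ge0// !mulr_ge0 ?invr_ge0 ?exprn_ge0 ?enorm_ge0 ?addr_ge0.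
have DM := is_diff_model s x y tp Tl.
have {}DM : 'd (model f p.+1 T s x) y v = _ :=
  congr1 (@^~ v) (@diff_val _ _ _ _ _ _ _ DM).
move: DM; rewrite -/w -/r.
pose D := \sum_(j < p.+1) (T (nseq j w ++ v :: nseq (p - j) w)
  - nabla f x (nseq j w ++ v :: nseq (p - j) w)).
have Dle : `|D| <= p.+1%:R * (B * r ^+ p * enorm v).
  apply: le_trans (ler_norm_sum _ _ _) _.
  rewrite -[X in X%:R * _]card_ord mulr_natl -sumr_const; apply: ler_sum => j _.
  have sz : size (nseq j w ++ v :: nseq (p - j) w) = p.+1.
    by rewrite size_cat /= !size_nseq addnS subnKC// -ltnS.
  apply: le_trans (TB sz) _.
  rewrite big_cat big_cons /= !prod_enorm_nseq -/r [X in B * X]mulrCA -exprD.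
  by rewrite subnKC -1?ltnS// (mulrC (enorm v)) mulrA.
have DE : \sum_(j < p.+1) T (nseq j w ++ v :: nseq (p.+1 - j.+1) w) =
    D + p.+1%:R * nabla f x (v :: nseq p w).
  rewrite /D sumrB; under eq_bigr do rewrite subSS.
  rewrite -[LHS]addr0 -addrA; congr (_ + _); apply/eqP.
  rewrite eq_sym addrC subr_eq0; apply/eqP.
  rewrite -[X in X%:R * _]card_ord mulr_natl -sumr_const; apply: eq_bigr => j _.
  by rewrite (nabla_nseq_move _ _ _ tf) subnKC// -ltnS.
rewrite DE.
rewrite big_add1 /=.
have -> : \sum_(0 <= i < p) i.+1`!%:R^-1 * (\sum_(j < i.+1)
    nabla f x (nseq j w ++ v :: nseq (i.+1 - j.+1) w)) =
    \sum_(i < p) i`!%:R^-1 * nabla f x (v :: nseq i w).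
  rewrite big_mkord; apply: eq_bigr => i _.
  rewrite (eq_bigr (fun=> nabla f x (v :: nseq i w))) => [|j _].
    rewrite sumr_const card_ord factS natrM invfM.
    rewrite -[X in _ * X = _]mulr_natl.
    by rewrite mulrACA mulVf ?mul1r// pnatr_eq0.
  have ij : (j + (i - j) = i)%N by rewrite subnKC// -ltnS.
  by rewrite subSS (nabla_nseq_move _ _ _ tf) ij// ltnS ltnW.
have tv : times_differentiable p (fun y => 'd f y v) by case: tf => _; apply.
have lv : lipschitz_derivative p (fun y => 'd f y v) (L * enorm v).
  move=> x' y' hs sz; have := lf x' y' (hs := v :: hs).
  rewrite /= sz big_cons => /(_ erefl) /le_trans; apply.
  by rewrite le_eqVlt; apply/orP; left; apply/eqP; ring.
set S := \sum_(i < p) _; set N := nabla f x (v :: nseq p w) => DM.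
have TE : `|'d f y v - (S + p`!%:R^-1 * N)| <= L * enorm v * r ^+ p.+1 / p.+1`!%:R.
  by have := taylor_lipschitz x y tv lv; rewrite big_ord_recr.
have CS := cauchy_schwarz w v; rewrite -/r in CS.
have GM := diff_le_enorm_grad (model f p.+1 T s x) y v.
have F1 : p`!%:R^-1 = p.+1%:R / p.+1`!%:R :> R.
  by rewrite factS natrM invfM mulrA mulfV ?mul1r// pnatr_eq0.
have F2 : p.+1`!%:R^-1 = p.+2%:R / p.+2`!%:R :> R.
  by rewrite (factS p.+1) natrM invfM mulrA mulfV ?mul1r// pnatr_eq0.
have I0 : 0 <= p.+1`!%:R^-1 :> R by rewrite invr_ge0.
have r0 : 0 <= r ^+ p by rewrite exprn_ge0// enorm_ge0.
apply: le_trans (gradient_split TE GM Dle CS DM F1 F2 I0 s0 r0) _.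
by rewrite le_eqVlt; apply/orP; left; apply/eqP; rewrite F1 exprS; ring.
Qed.

End ModelError.

End Gradients.

Section FiniteDifferences.
Context {R : realType} {n : nat}.
Implicit Types (f g : 'rV[R]_n -> R) (x y z v : 'rV[R]_n) (L h : R) (p : nat).

Lemma lipschitz_derivative_form_norm p f L : times_differentiable p f ->
  (forall x y, form_norm p (fun hs => nabla f x hs - nabla f y hs)
     <= L * enorm (x - y)) ->
  lipschitz_derivative p f L.
Proof.
move=> tf lf x y hs sz.
have Tl := multilinearB (multilinear_nabla x tf) (multilinear_nabla y tf).
apply: le_trans (le_form_norm Tl sz) (ler_wpM2r _ (lf x y)).
by apply: prodr_ge0 => h _; exact: enorm_ge0.
Qed.

Lemma lipschitz_derivative_le p f L1 L2 : L1 <= L2 ->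
  lipschitz_derivative p f L1 -> lipschitz_derivative p f L2.
Proof.
move=> L12 lf x y hs sz; apply: le_trans (lf x y hs sz) _.
rewrite -!mulrA ler_wpM2r// mulr_ge0 ?enorm_ge0 ?prodr_ge0// => h _.
exact: enorm_ge0.
Qed.

Lemma multilinear_fd_tensor p f z h : times_differentiable p f ->
  multilinear p.+1 (fd_tensor f z h).
Proof.
move=> tf; apply: multilinear_sum => i; apply: multilinear_otimes.
move=> hs1 hs2 a u v sz.
by rewrite !(multilinear_nabla _ tf)//; ring.
Qed.

Lemma fd_tensor_error p f z h L hs : times_differentiable p.+1 f ->
  lipschitz_derivative p.+1 f L -> 0 <= L -> 0 < h -> size hs = p.+1 ->
  `|fd_tensor f z h hs - nabla f z hs|
    <= Num.sqrt n%:R * (L * h / 2) * \prod_(k <- hs) enorm k.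
Proof.
move=> tf lf L0 h0; case: (lastP hs) => [//|gs e]; rewrite size_rcons => -[sz].
rewrite -cats1 nabla_cat /= big_cat big_seq1 /=.
set g := fun y => nabla f y gs.
have tg : times_differentiable 1 g.
  by apply: times_differentiable_nabla; rewrite sz addn1.
have lg : lipschitz_derivative 1 g (L * \prod_(k <- gs) enorm k).
  move=> x y [|k []]//= _; have := lf x y (gs ++ [:: k]).
  rewrite size_cat sz addn1 !nabla_cat /= big_cat big_seq1 /= => /(_ erefl).
  move=> /le_trans; apply.
  rewrite le_eqVlt; apply/orP; left; apply/eqP; ring.
have -> : 'd g z e = \sum_i ('d g z (basis_vec i)) * e 0 i.
  rewrite [in LHS](sum_basis e) linear_sum; apply: eq_bigr => i _.
  by rewrite linearZ mulrC.
rewrite /fd_tensor /otimes -sumrB.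
apply: le_trans (ler_norm_sum _ _ _) _.
have P0 : 0 <= \prod_(k <- gs) enorm k.
  by apply: prodr_ge0 => k _; exact: enorm_ge0.
have H i : `|(g (z + h *: basis_vec i) - g z) / h * dot (basis_vec i) e -
    'd g z (basis_vec i) * e 0 i| <= L * h / 2 * (\prod_(k <- gs) enorm k) * `|e 0 i|.
  rewrite dot_basis -mulrBl normrM ler_wpM2r//.
  have := taylor_lipschitz z (z + h *: basis_vec i) tg lg.
  rewrite addrAC subrr add0r enormZ enorm_basis mulr1 (gtr0_norm h0).
  rewrite !big_ord_recr big_ord0 /= add0r invr1 !mul1r linearZ /=.
  move: (g (z + _)) (g z) ('d g z _) => a b d; rewrite /GRing.scale/= => E.
  have -> : (a - b) / h - d = h^-1 * (a - (b + h * d)).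
    by field; rewrite gt_eqF.
  rewrite normrM gtr0_norm ?invr_gt0// ler_pdivrMl//; apply: le_trans E _.
  rewrite (_ : 2`! = 2)%N//.
  by rewrite le_eqVlt; apply/orP; left; apply/eqP; field.
have E : take (size (gs ++ [:: e])).-1 (gs ++ [:: e]) = gs.
  by rewrite size_cat addn1 take_size_cat.
rewrite last_cat /=.
under eq_bigr do rewrite E.
apply: le_trans (ler_sum _ (fun i _ => H i)) _; rewrite -mulr_sumr.
apply: le_trans (ler_wpM2l _ (sum_norm_le_enorm e)) _.
  by rewrite !mulr_ge0// ltW.
by rewrite le_eqVlt; apply/orP; left; apply/eqP; ring.
Qed.

End FiniteDifferences.

Section StepInequalities.
Context {R : realType}.
Implicit Types (r s u c d e L sg m t A D : R) (q : nat).

Lemma young_pow r c q : 0 <= r -> 0 <= c ->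
  q.+1%:R * r * c ^+ q <= r ^+ q.+1 + q%:R * c ^+ q.+1.
Proof.
move=> r0 c0; elim: q => [|q IH]; first by rewrite !expr1 expr0 mul0r addr0 mulr1 mul1r.
have H : r * c ^+ q.+1 + c * r ^+ q.+1 <= r ^+ q.+2 + c ^+ q.+2.
  rewrite -subr_ge0.
  have -> : r ^+ q.+2 + c ^+ q.+2 - (r * c ^+ q.+1 + c * r ^+ q.+1) =
    (r ^+ q.+1 - c ^+ q.+1) * (r - c).
    by rewrite [r ^+ q.+2]exprS [c ^+ q.+2]exprS; ring.
  have [rc|cr] := lerP r c.
    by rewrite mulr_le0// subr_le0// lerXn2r.
  by rewrite mulr_ge0// subr_ge0 ?lerXn2r// ltW.
have -> : q.+2%:R * r * c ^+ q.+1 = c * (q.+1%:R * r * c ^+ q) + r * c ^+ q.+1.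
  by rewrite -(natr1 q.+1) exprS; ring.
apply: (@le_trans _ _ (c * (r ^+ q.+1 + q%:R * c ^+ q.+1) + r * c ^+ q.+1)).
  by rewrite lerD2r ler_wpM2l.
have -> : q.+1%:R * c ^+ q.+2 = q%:R * c ^+ q.+2 + c ^+ q.+2 by rewrite -(natr1 q); ring.
by move: H; rewrite [c ^+ q.+2]exprS; lra.
Qed.

Lemma mul_pow_le r u q : 0 <= r -> 0 <= u -> u * r ^+ q <= r ^+ q.+1 + u ^+ q.+1.
Proof.
move=> r0 u0; have [ru|ur] := lerP r u.
  apply: (@le_trans _ _ (u ^+ q.+1)); last by rewrite lerDr exprn_ge0.
  by rewrite exprS ler_wpM2l// lerXn2r.
apply: (@le_trans _ _ (r ^+ q.+1)); last by rewrite lerDl exprn_ge0.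
by rewrite exprS ler_wpM2r ?exprn_ge0// ltW.
Qed.

Lemma step_length_bound r u e q : 0 <= r -> 0 <= u -> 0 < e ->
  e ^+ q.+1 <= 35 / 22 * r ^+ q.+1 + 11^-1 * (u * r ^+ q) + 88^-1 * (e * r ^+ q) ->
  e ^+ q.+2 <= 3 * (r ^+ q.+2 + u ^+ q.+2).
Proof.
move=> r0 u0 e0 H; pose w := Num.max r u.
have rw : r <= w by rewrite le_max lexx.
have uw : u <= w by rewrite le_max lexx orbT.
have w0 : 0 <= w := le_trans r0 rw.
have Pw k : 0 <= w ^+ k by rewrite exprn_ge0.
have wru : w ^+ q.+2 <= r ^+ q.+2 + u ^+ q.+2.
  by rewrite /w; case: (leP r u) => _; rewrite ?lerDl ?lerDr exprn_ge0.
suff : e ^+ q.+2 <= 3 * w ^+ q.+2 by move=> h; apply: le_trans h _; rewrite ler_pM2l.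
have {}H : e ^+ q.+1 <= 37 / 22 * w ^+ q.+1 + 88^-1 * (e * w ^+ q).
  have h1 : r ^+ q.+1 <= w ^+ q.+1 by rewrite lerXn2r.
  have h2 : u * r ^+ q <= w ^+ q.+1.
    by rewrite exprS ler_pM ?exprn_ge0// lerXn2r.
  have h3 : e * r ^+ q <= e * w ^+ q by rewrite ler_pM2l// lerXn2r.
  lra.
have [ew|we] := lerP e w.
  apply: (@le_trans _ _ (w ^+ q.+2)); first by rewrite lerXn2r ?nnegrE// ltW.
  by have := Pw q.+2; lra.
have h : e * w ^+ q <= e ^+ q.+1.
  by rewrite exprS ler_pM2l// lerXn2r ?nnegrE// ltW.
have {}H : 87 * e ^+ q.+1 <= 148 * w ^+ q.+1 by lra.
have wp : 0 < w.
  rewrite lt_def w0 andbT; apply/eqP => w_eq0.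
  by move: H; rewrite w_eq0 expr0n mulr0 leNgt pmulr_rgt0// exprn_gt0.
rewrite -(@ler_pM2r _ (w ^+ q)) ?exprn_gt0//.
have E0 : 0 <= e ^+ q.+1 by rewrite exprn_ge0// ltW.
have sq : (87 * e ^+ q.+1) * (87 * e ^+ q.+1) <= (148 * w ^+ q.+1) * (148 * w ^+ q.+1).
  by rewrite ler_pM// mulr_ge0.
apply: (@le_trans _ _ (e ^+ q.+1 * e ^+ q.+1)).
  have -> : e ^+ q.+1 * e ^+ q.+1 = e ^+ q.+2 * e ^+ q by rewrite -!exprD !addSn addnS.
  rewrite ler_wpM2l ?exprn_ge0 ?(ltW e0)//.
  by rewrite lerXn2r ?nnegrE// ltW.
have -> : 3 * w ^+ q.+2 * w ^+ q = 3 * (w ^+ q.+1 * w ^+ q.+1).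
  by rewrite -mulrA -!exprD !addSn addnS.
have : 0 <= w ^+ q.+1 * w ^+ q.+1 by rewrite mulr_ge0.
move: sq; clear; move: (e ^+ q.+1) (w ^+ q.+1) => E W; lra.
Qed.

(* Here p = q + 1, r = |x_(t+1) - x_t|, s = |x_t - x_0|, u = s / m, d bounds the
   error of the finite-difference tensor, and e = (eps / sg)^(1/p) is the length
   at which sg e^p equals the gradient tolerance eps. *)
Lemma gradient_step r s u e L sg d m eps q : 0 <= r -> 0 <= u -> 0 < e ->
  0 < L -> 1 <= m -> 0 <= d -> s = m * u -> sg = 11 * q.+2%:R * L * m ->
  sg * e ^+ q.+1 = eps -> q.+2%:R * d <= sg * e / 88 ->
  eps < sg / (2 * q.+1`!%:R) * r ^+ q.+1 + (L + sg) * r ^+ q.+1 / q.+1`!%:R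
        + (L * s + d) * r ^+ q / q`!%:R ->
  e ^+ q.+2 <= 3 * (r ^+ q.+2 + u ^+ q.+2).
Proof.
move=> r0 u0 e0 L0 m1 d0 sE sgE epsE dle H.
apply: step_length_bound => //.
have q2 : 2 <= q.+2%:R :> R by rewrite ler_nat.
have m0 : 0 < m by lra.
have Lm : L <= L * m by rewrite ler_pMr.
have Lm0 : 0 < L * m by rewrite mulr_gt0.
have Lsg : 22 * (L * m) <= sg.
  have -> : sg = 11 * (q.+2%:R * (L * m)) by rewrite sgE; ring.
  have : 2 * (L * m) <= q.+2%:R * (L * m) by rewrite ler_pM2r.
  lra.
have sg0 : 0 < sg by lra.
have F0 : 0 < q`!%:R :> R by rewrite ltr0n fact_gt0.
have F1 : 0 < q.+1`!%:R :> R by rewrite ltr0n fact_gt0.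
have FE : q.+1`!%:R = q.+1%:R * q`!%:R :> R by rewrite factS natrM.
have eps0 : 0 < eps by rewrite -epsE mulr_gt0// exprn_gt0.
have F1' : 1 <= q.+1`!%:R :> R by rewrite ler1n fact_gt0.
have : eps < sg / 2 * r ^+ q.+1 + (L + sg) * r ^+ q.+1
        + q.+1%:R * (L * s + d) * r ^+ q.
  apply: (@le_lt_trans _ _ (q.+1`!%:R * eps)); first by rewrite ler_peMl// ltW.
  rewrite -(ltr_pM2l F1) in H; apply: lt_le_trans H _.
  rewrite le_eqVlt; apply/orP; left; apply/eqP; rewrite FE.
  by field; rewrite gt_eqF//= addrC natr1 pnatr_eq0.
have q12 : q.+1%:R <= q.+2%:R :> R by rewrite ler_nat.
have h1 : q.+1%:R * (L * s) * r ^+ q <= sg / 11 * (u * r ^+ q).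
  have -> : sg / 11 * (u * r ^+ q) = q.+2%:R * (L * s) * r ^+ q.
    by rewrite sgE sE; field.
  by rewrite ler_wpM2r ?exprn_ge0// ler_wpM2r// sE !mulr_ge0// ltW.
have h2 : q.+1%:R * d * r ^+ q <= sg * e / 88 * r ^+ q.
  rewrite ler_wpM2r ?exprn_ge0//; apply: le_trans dle.
  by rewrite ler_wpM2r.
have R1 : 0 <= r ^+ q.+1 by rewrite exprn_ge0.
have h3 : L * r ^+ q.+1 <= sg / 11 * r ^+ q.+1.
  by rewrite ler_wpM2r//; lra.
rewrite -epsE => {}H; rewrite -(ler_pM2l sg0).
move: (u * r ^+ q) h1 => ur h1.
move: H h1 h2 h3; clear; move: (e ^+ q.+1) (r ^+ q.+1) (r ^+ q) => eq rq1 rq.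
lra.
Qed.

Lemma decrease_step r s u e L sg d m q D : 0 <= r -> 0 <= u -> 0 < e ->
  0 < L -> 1 <= m -> 0 <= d -> s = m * u -> sg = 11 * q.+2%:R * L * m ->
  q.+2%:R * d <= sg * e / 88 ->
  e ^+ q.+2 <= 3 * (r ^+ q.+2 + u ^+ q.+2) ->
  (sg - L) * r ^+ q.+2 - q.+2%:R * (L * s + d) * r ^+ q.+1 <= D ->
  sg * (17 / 22 * r ^+ q.+2 - u ^+ q.+2 / 8) <= D.
Proof.
move=> r0 u0 e0 L0 m1 d0 sE sgE dle eb; apply: le_trans.
have q2 : 2 <= q.+2%:R :> R by rewrite ler_nat.
have m0 : 0 < m by lra.
have Lm : L <= L * m by rewrite ler_pMr.
have Lm0 : 0 < L * m by rewrite mulr_gt0.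
have Lsg : 22 * (L * m) <= sg.
  have -> : sg = 11 * (q.+2%:R * (L * m)) by rewrite sgE; ring.
  have : 2 * (L * m) <= q.+2%:R * (L * m) by rewrite ler_pM2r.
  lra.
have sg0 : 0 < sg by lra.
have R2 : 0 <= r ^+ q.+2 by rewrite exprn_ge0.
have h1 : L * r ^+ q.+2 <= sg / 11 * r ^+ q.+2 by rewrite ler_wpM2r//; lra.
have h2 : q.+2%:R * (L * s) * r ^+ q.+1 <= sg / 11 * (r ^+ q.+2 + u ^+ q.+2).
  have -> : q.+2%:R * (L * s) * r ^+ q.+1 = sg / 11 * (u * r ^+ q.+1).
    by rewrite sgE sE; field.
  by rewrite ler_wpM2l ?divr_ge0 ?(ltW sg0)// mul_pow_le.
have h3 : q.+2%:R * d * r ^+ q.+1 <= sg / 88 * (r ^+ q.+2 + e ^+ q.+2).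
  apply: (@le_trans _ _ (sg / 88 * (e * r ^+ q.+1))).
    by rewrite mulrA ler_wpM2r ?exprn_ge0// mulrAC.
  by rewrite ler_wpM2l ?divr_ge0 ?(ltW sg0)// mul_pow_le// ltW.
have h4 : sg / 88 * e ^+ q.+2 <= sg / 88 * (3 * (r ^+ q.+2 + u ^+ q.+2)).
  by rewrite ler_wpM2l ?divr_ge0 ?(ltW sg0).
move: h1 h2 h3 h4; clear; move: (e ^+ q.+2) (r ^+ q.+2) (r ^+ q.+1) (u ^+ q.+2).
move=> e2 r2 r1 u2; lra.
Qed.

Lemma decrease_sum_step (A a b r2 u2 : R) : u2 <= A * b -> 0 <= a * r2 -> 0 <= b * r2 ->
  (17 / 22 - (a + b / 8)) * (A + r2)
    <= (17 / 22 - a) * A + (17 / 22 * r2 - u2 / 8).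
Proof. by move=> *; lra. Qed.

Lemma length_sum_step (A a b r2 u2 : R) : u2 <= A * b -> 0 <= a * r2 -> 0 <= b * r2 ->
  3 * (1 + a) * A + 3 * (r2 + u2) <= 3 * (1 + (a + b)) * (A + r2).
Proof. by move=> *; lra. Qed.

Lemma length_le_decrease (sg A a l D1 D2 : R) : 0 < sg -> 0 <= A -> a <= 1 ->
  l <= 3 * (1 + a) * A -> sg * (17 / 22 - a / 8) * A <= D1 -> D1 <= D2 ->
  sg * l <= 64 * D2.
Proof.
move=> sg0 A0 a1 lA D1le D12.
have h1 : sg * l <= 6 * (sg * A).
  rewrite mulrCA ler_pM2l//; apply: le_trans lA _; rewrite ler_wpM2r//; lra.
have h2 : 1 / 2 * (sg * A) <= sg * (17 / 22 - a / 8) * A.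
  rewrite mulrA ler_wpM2r// mulrC ler_pM2l//; lra.
have : 0 <= sg * A by rewrite mulr_ge0// ltW.
lra.
Qed.

End StepInequalities.

Section StepScale.
Context {R : realType}.
Implicit Types (s eps L m : R) (q n : nat).

Definition step_scale p s eps := (eps / s) `^ (p%:R^-1).

Lemma step_scale_gt0 p s eps : 0 < s -> 0 < eps -> 0 < step_scale p s eps.
Proof. by move=> s0 e0; rewrite powR_gt0// divr_gt0. Qed.

Lemma step_scaleX q s eps : 0 < s -> 0 < eps ->
  s * step_scale q.+1 s eps ^+ q.+1 = eps.
Proof.
move=> s0 e0; rewrite -powR_mulrn ?powR_ge0// -powRrM mulVf ?pnatr_eq0//.
by rewrite powRr1 ?divr_ge0 ?ltW// mulrC divfK// gt_eqF.
Qed.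

Lemma eps_powE q eps : 0 < eps -> eps_pow q.+1 eps = eps * eps `^ (q.+1%:R^-1).
Proof.
move=> e0; rewrite /eps_pow -{2}(powRr1 (ltW e0)) -powRD; last first.
  by rewrite gt_eqF ?implybT.
by congr (_ `^ _); rewrite -(natr1 q.+1) mulrDl divff ?pnatr_eq0// mul1r.
Qed.

Lemma eps_pow_step_scale q s eps : 0 < s -> 0 < eps ->
  eps_pow q.+1 eps / s `^ (q.+1%:R^-1) = s * step_scale q.+1 s eps ^+ q.+2.
Proof.
move=> s0 e0; have E := step_scaleX q s0 e0.
rewrite eps_powE// exprS mulrCA E /step_scale powRM ?invr_ge0 ?ltW//.
rewrite -(powR_inv1 (ltW s0)) -powRrM mulN1r powRN.
by rewrite -mulrA mulrC.
Qed.

Lemma fd_step_gt0 n q s eps : (0 < n)%N -> 0 < s -> 0 < eps -> 0 < fd_step n q s eps.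
Proof.
move=> n0 s0 e0; rewrite /fd_step mulr_gt0 ?divr_gt0 ?mulr_gt0 ?sqrtr_gt0 ?ltr0n//.
rewrite powR_gt0// divr_gt0 ?mulr_gt0 ?exprn_gt0 ?powR_gt0//.
Qed.

Lemma fd_step_le n q s eps L m : (0 < n)%N -> 0 < L -> 1 <= m -> 0 < eps ->
  s = 11 * q.+2%:R * L * m ->
  q.+2%:R * (Num.sqrt n%:R * (L * fd_step n q.+1 s eps / 2))
    <= s * step_scale q.+1 s eps / 88.
Proof.
move=> n0 L0 m1 e0 sE.
have q0 : 0 < q.+2%:R :> R by [].
have m0 : 0 < m by lra.
have s0 : 0 < s by rewrite sE !mulr_gt0.
have sn0 : 0 < Num.sqrt n%:R :> R by rewrite sqrtr_gt0 ltr0n.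
have t0 := step_scale_gt0 q.+1 s0 e0; set t := step_scale _ _ _ in t0 *.
rewrite /fd_step; set Y := (X in X `^ _).
have Yle : Y `^ (q.+2%:R^-1) <= s * t / 16.
  have st0 : 0 <= s * t / 16 by rewrite ltW// divr_gt0// mulr_gt0.
  have -> : s * t / 16 = ((s * t / 16) ^+ q.+2) `^ (q.+2%:R^-1).
    by rewrite -powR_mulrn// -powRrM mulfV ?pnatr_eq0// powRr1.
  have k0 : 0 < 3 `^ (q.+1%:R^-1) :> R by rewrite powR_gt0.
  have k1 : 1 <= 3 `^ (q.+1%:R^-1) :> R.
    apply: (@le_trans _ _ (3 `^ 0)); first by rewrite powRr0.
    by rewrite ler_powR ?ler1n.
  have YE : Y = (s * t) ^+ q.+2 / ((8 * q.+2%:R) ^+ q.+1 * 2 ^+ 7 * 3 `^ (q.+1%:R^-1)).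
    have := eps_pow_step_scale q s0 e0; rewrite -/t /Y => E.
    have -> : (s * t) ^+ q.+2 = s ^+ q.+1 * (eps_pow q.+1 eps / s `^ (q.+1%:R^-1)).
      by rewrite E exprMn mulrA -exprSr.
    rewrite [in LHS]invfM.
    by move: (_^-1 : R) (s `^ _)^-1 (s ^+ _) (eps_pow _ _) => *; ring.
  have Kge : 16 ^+ q.+2 <= (8 * q.+2%:R) ^+ q.+1 * 2 ^+ 7 * 3 `^ (q.+1%:R^-1) :> R.
    rewrite -[leLHS]mulr1 exprSr ler_pM ?mulr_ge0 ?exprn_ge0//.
    rewrite ler_pM ?exprn_ge0//; last by lra.
    have : 2 <= q.+2%:R :> R by rewrite ler_nat.
    by move=> ?; rewrite lerXn2r ?nnegrE ?mulr_ge0//; lra.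
  apply: ge0_ler_powR; rewrite ?nnegrE ?invr_ge0 ?exprn_ge0//.
    rewrite YE divr_ge0 ?exprn_ge0 ?mulr_ge0 ?exprn_ge0 ?powR_ge0//; exact: ltW.
  rewrite YE [leRHS]exprMn [in leRHS]exprVn ler_wpM2l ?exprn_ge0//.
    by rewrite ltW// mulr_gt0.
  rewrite lef_pV2// posrE ?exprn_gt0// !mulr_gt0 ?exprn_gt0//.
move: (Y `^ _) Yle => Yr Yle.
have -> : q.+2%:R * (Num.sqrt n%:R * (L * (4 / (s * Num.sqrt n%:R) * Yr) / 2)) =
    2 / (11 * m) * Yr.
  by rewrite sE; field; rewrite !gt_eqF.
apply: (@le_trans _ _ (2 / (11 * m) * (s * t / 16))).
  by rewrite ler_wpM2l// divr_ge0// mulr_ge0// ltW.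
have st0 : 0 <= s * t by rewrite ltW// mulr_gt0.
have -> : 2 / (11 * m) * (s * t / 16) = m^-1 * (s * t / 88).
  by field; rewrite gt_eqF.
by rewrite ler_piMl ?divr_ge0// invf_le1.
Qed.

End StepScale.

Section InnerLoop.
Context {R : realType} {n : nat}.
Implicit Types (x y z : 'rV[R]_n) (t c : nat) (a : outcome).

Section NoHalt.
Variables (f : 'rV[R]_n -> R) (q m : nat) (L eps : R) (x0 : 'rV[R]_n).
Hypotheses (n0 : (0 < n)%N) (m0 : (0 < m)%N) (L0 : 0 < L) (eps0 : 0 < eps).
Hypotheses (tf : times_differentiable q.+1 f) (lf : lipschitz_derivative q.+1 f L).
Let sg : R := sigma q.+1 m L.
Let T := fd_tensor f x0 (fd_step n q.+1 sg eps).
Let e : R := step_scale q.+1 sg eps.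

(* A plays the role of the sum of the (q+2)-th powers of the first t steps; the
   second item, for all c, is the power-mean inequality bounding the distance
   |x_t - x_0| by these steps. *)
Definition inner_invariant t x := exists A : R,
  [/\ 0 <= A,
      forall c : R, 0 <= c -> q.+2%:R * enorm (x - x0) * c ^+ q.+1
        <= A + q.+1%:R * t%:R * c ^+ q.+2,
      sg * (17 / 22 - t%:R / (8 * m%:R)) * A <= q.+2`!%:R * (f x0 - f x) &
      e ^+ q.+2 * t%:R <= 3 * (1 + t%:R / m%:R) * A].

Lemma inner_invariant0 : inner_invariant 0 x0.
Proof.
exists 0; split=> [//|c _||].
- by rewrite subrr enorm0 !mulr0 !mul0r addr0.
- by rewrite subrr !mulr0.
- by rewrite !mulr0.
Qed.

Let m1 : 1 <= m%:R :> R. Proof. by rewrite ler1n. Qed.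

Let sg0 : 0 < sg.
Proof. by rewrite /sg /sigma !mulr_gt0// ltr0n. Qed.

Lemma inner_invariantS t x x' : (t < m)%N -> inner_invariant t x ->
  approx_min f q.+1 T sg x x' -> eps < enorm (grad f x') ->
  inner_invariant t.+1 x'.
Proof.
move=> tm [A [A0 As Ad Ae]] [Mle Mgrad] ge.
pose r := enorm (x' - x); pose s := enorm (x - x0); pose u := s / m%:R.
have r0 : 0 <= r := enorm_ge0 _; have s0 : 0 <= s := enorm_ge0 _.
have mR0 : 0 < m%:R :> R by rewrite ltr0n.
have u0 : 0 <= u by rewrite divr_ge0// ltW.
have e0 : 0 < e := step_scale_gt0 q.+1 sg0 eps0.
have sE : s = m%:R * u by rewrite /u mulrC divfK// gt_eqF.
have sgE : sg = 11 * q.+2%:R * L * m%:R by [].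
have h0 := fd_step_gt0 q.+1 n0 sg0 eps0.
pose h := fd_step n q.+1 sg eps.
pose d : R := Num.sqrt n%:R * (L * h / 2).
have d0 : 0 <= d by rewrite mulr_ge0 ?sqrtr_ge0// divr_ge0// ltW// mulr_gt0.
have dle : q.+2%:R * d <= sg * e / 88 := fd_step_le n0 L0 m1 eps0 sgE.
have Tl : multilinear q.+1 T.
  by apply: multilinear_fd_tensor; exact: times_differentiable_le tf.
have TB hs : size hs = q.+1 ->
    `|T hs - nabla f x hs| <= (L * s + d) * \prod_(k <- hs) enorm k.
  move=> sz; have -> : T hs - nabla f x hs =
      (T hs - nabla f x0 hs) + (nabla f x0 hs - nabla f x hs) by ring.
  apply: le_trans (ler_normD _ _) _; rewrite mulrDl addrC lerD//.
    by apply: le_trans (lf x0 x sz) _; rewrite -enormN opprB.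
  by have := fd_tensor_error x0 tf lf (ltW L0) h0 sz.
have B0 : 0 <= L * s + d by rewrite addr_ge0// mulr_ge0// ltW.
have fx' := le_model sg x' tf lf TB.
have gx' := enorm_grad_le_model x' tf lf Tl TB (ltW L0) B0 (ltW sg0).
have {gx'}G : e ^+ q.+2 <= 3 * (r ^+ q.+2 + u ^+ q.+2).
  apply: (gradient_step r0 u0 e0 L0 m1 d0 sE sgE (step_scaleX q sg0 eps0) dle).
  apply: lt_le_trans ge (le_trans gx' _).
  by rewrite !lerD2r.
have D : sg * (17 / 22 * r ^+ q.+2 - u ^+ q.+2 / 8) <= q.+2`!%:R * (f x - f x').
  apply: (decrease_step r0 u0 e0 L0 m1 d0 sE sgE dle G).
  have F2 : 0 < q.+2`!%:R :> R by rewrite ltr0n fact_gt0.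
  rewrite -ler_pdivrMl//.
  have -> : q.+2`!%:R^-1 * ((sg - L) * r ^+ q.+2 - q.+2%:R * (L * s + d) * r ^+ q.+1)
    = - ((L - sg) * r ^+ q.+2 / q.+2`!%:R + (L * s + d) * r ^+ q.+1 / q.+1`!%:R).
    rewrite (factS q.+1) natrM; field.
    by rewrite pnatr_eq0 -lt0n fact_gt0 -natrD pnatr_eq0.
  by rewrite lerBrDl lerBlDr (le_trans fx')// -addrA lerD2r.
have U : m%:R * u ^+ q.+2 <= A.
  rewrite -(lerD2r (q.+1%:R * m%:R * u ^+ q.+2)).
  have -> : m%:R * u ^+ q.+2 + q.+1%:R * m%:R * u ^+ q.+2 =
      q.+2%:R * s * u ^+ q.+1 by rewrite sE -(natr1 q.+1) [u ^+ q.+2]exprS; ring.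
  apply: le_trans (As _ u0) _; rewrite lerD2l ler_wpM2r ?exprn_ge0//.
  by rewrite ler_wpM2l// ler_nat ltnW.
have {}U : u ^+ q.+2 <= A / m%:R by rewrite ler_pdivlMr// mulrC.
have R0 : 0 <= r ^+ q.+2 by rewrite exprn_ge0.
exists (A + r ^+ q.+2); split.
- by rewrite addr_ge0.
- move=> c c0; have Y := young_pow q.+1 r0 c0.
  have S : enorm (x' - x0) <= s + r.
    have -> : x' - x0 = (x - x0) + (x' - x) by rewrite [RHS]addrC addrA subrK.
    exact: enormD.
  apply: (@le_trans _ _ (q.+2%:R * (s + r) * c ^+ q.+1)).
    by rewrite ler_wpM2r ?exprn_ge0// ler_wpM2l.
  have -> : q.+2%:R * (s + r) * c ^+ q.+1 =
    q.+2%:R * s * c ^+ q.+1 + q.+2%:R * r * c ^+ q.+1 by ring.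
  apply: le_trans (lerD (As _ c0) Y) _.
  by rewrite le_eqVlt -(natr1 t); apply/orP; left; apply/eqP; ring.
- have -> : f x0 - f x' = (f x0 - f x) + (f x - f x') by ring.
  rewrite [leRHS]mulrDr; apply: le_trans _ (lerD Ad D).
  rewrite -[leLHS]mulrA -[X in _ <= X + _]mulrA -mulrDr ler_pM2l// -(natr1 t).
  have -> : (t%:R + 1) / (8 * m%:R) = t%:R / (8 * m%:R) + m%:R^-1 / 8 :> R.
    by field; rewrite gt_eqF.
  apply: decrease_sum_step U _ _; first by rewrite mulr_ge0// divr_ge0// mulr_ge0.
  by rewrite mulr_ge0// invr_ge0.
- rewrite -(natr1 t) mulrDr mulr1; apply: le_trans (lerD Ae G) _.
  rewrite (mulrDl t%:R) mul1r.
  apply: length_sum_step U _ _; first by rewrite mulr_ge0// divr_ge0.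
  by rewrite mulr_ge0// invr_ge0.
Qed.

Lemma inner_invariant_decrease t x xt : (t < m)%N -> inner_invariant t.+1 x ->
  f xt <= f x -> enough_decrease f q.+1 sg eps x0 t xt.
Proof.
move=> tm [A [A0 _ Ad Ae]] fxt; rewrite /enough_decrease.
have F2 : 0 < q.+2`!%:R :> R by rewrite ltr0n fact_gt0.
have mR0 : 0 < m%:R :> R by rewrite ltr0n.
have tm1 : t.+1%:R / m%:R <= 1 :> R by rewrite ler_pdivrMr// mul1r ler_nat.
have k1 : 1 <= 3 `^ (q.+1%:R^-1) :> R.
  apply: (@le_trans _ _ (3 `^ 0)); first by rewrite powRr0.
  by rewrite ler_powR ?ler1n.
have E := eps_pow_step_scale q sg0 eps0; rewrite -/e in E.
have -> : eps_pow q.+1 eps / (2 ^+ 6 * 3 `^ (q.+1%:R^-1) * sg `^ (q.+1%:R^-1) *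
    q.+2`!%:R) * t.+1%:R =
    (3 `^ (q.+1%:R^-1))^-1 * (sg * (e ^+ q.+2 * t.+1%:R) / (64 * q.+2`!%:R)).
  rewrite (_ : sg * (_ * _) = eps_pow q.+1 eps / sg `^ (q.+1%:R^-1) * t.+1%:R).
    rewrite (_ : 2 ^+ 6 = 64 :> R); last by ring.
    rewrite ![in LHS]invfM [in RHS](invfM 64).
    by move: (eps_pow _ _) (sg `^ _)^-1 (3 `^ _)^-1 (q.+2`!%:R^-1) => *; ring.
  by rewrite mulrA E.
have e2 : 0 <= e ^+ q.+2 * t.+1%:R by rewrite mulr_ge0// exprn_ge0// powR_ge0.
apply: (@le_trans _ _ (sg * (e ^+ q.+2 * t.+1%:R) / (64 * q.+2`!%:R))).
  apply: ler_piMl; last by rewrite invf_le1// powR_gt0.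
  apply: divr_ge0; first exact: mulr_ge0 (ltW sg0) e2.
  by rewrite mulr_ge0// ltW.
rewrite ler_pdivrMr ?mulr_gt0// [leRHS]mulrC -[leRHS]mulrA.
have h : q.+2`!%:R * (f x0 - f x) <= q.+2`!%:R * (f x0 - f xt) :> R.
  by rewrite ler_pM2l// lerD2l lerN2.
apply: (length_le_decrease sg0 A0 tm1 Ae _ h).
apply: le_trans _ Ad.
by rewrite (_ : t.+1%:R / (8 * m%:R) = t.+1%:R / m%:R / 8)//; field; rewrite gt_eqF.
Qed.

Lemma lazy_loop_no_halt t x xt z a c :
  lazy_loop f q.+1 T sg m eps x0 t x xt z a c -> (t <= m)%N ->
  inner_invariant t x -> a <> halt.
Proof.
elim=> {t x xt z a c} //.
- move=> t x xt x' xt' tm am [_ _ fle] ge ned le_tm inv.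
  have ltm : (t < m)%N by rewrite ltn_neqAle tm.
  by case: ned; exact: inner_invariant_decrease (inner_invariantS ltm inv am ge) fle.
- move=> t x xt x' xt' z a c tm am _ ge _ _ IH le_tm inv.
  have ltm : (t < m)%N by rewrite ltn_neqAle tm.
  by apply: IH => //; exact: inner_invariantS inv am ge.
Qed.

Lemma lazy_tensor_steps_no_halt z a c :
  lazy_tensor_steps f q.+1 x0 T sg m eps z a c -> a <> halt.
Proof. by move=> /lazy_loop_no_halt; apply=> //; exact: inner_invariant0. Qed.

End NoHalt.

Variables (f : 'rV[R]_n -> R) (p m : nat) (T : Defs.form R n) (s eps : R).
Variable x0 : 'rV[R]_n.

Lemma lazy_loop_calls t x xt z a c :
  lazy_loop f p T s m eps x0 t x xt z a c -> (t <= m)%N -> (c <= 2 * (m - t))%N.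
Proof.
have H t' : t' != m -> (t' <= m)%N -> (0 < m - t')%N.
  by move=> tm le; rewrite subn_gt0 ltn_neqAle tm.
elim=> {t x xt z a c} [|t x xt x' xt' tm _ _ _ le|t x xt x' xt' tm _ _ _ _ le|] //.
- by have := H t tm le; lia.
- by have := H t tm le; lia.
- move=> t x xt x' xt' z a c tm _ _ _ _ _ IH le; have := H t tm le.
  by move=> lt; have := IH ltac:(lia); lia.
Qed.

Lemma lazy_loop_solution t x xt z a c :
  lazy_loop f p T s m eps x0 t x xt z a c -> a = solution -> enorm (grad f z) <= eps.
Proof. by elim. Qed.

Lemma lazy_loop_le t x xt z a c :
  lazy_loop f p T s m eps x0 t x xt z a c -> a <> solution -> f z <= f xt.
Proof.
elim=> {t x xt z a c} //.
- by move=> t x xt x' xt' _ _ [_ fle _].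
- by move=> t x xt x' xt' z a c _ _ [_ fle _] _ _ _ IH /IH h; exact: le_trans h fle.
Qed.

Lemma lazy_loop_success t x xt z a c :
  lazy_loop f p T s m eps x0 t x xt z a c -> a = success -> (t <= m)%N ->
  (t = m -> z = xt) /\ ((t < m)%N -> enough_decrease f p s eps x0 m.-1 z).
Proof.
elim=> {t x xt z a c} //.
- by split=> //; rewrite ltnn.
- move=> t x xt x' xt' z a c tm _ _ _ dec _ IH /IH {}IH le_tm.
  have ltm : (t < m)%N by rewrite ltn_neqAle tm.
  split=> [tE|_]; first by rewrite tE eqxx in tm.
  have [IH1 IH2] := IH ltm.
  move: ltm; rewrite leq_eqVlt => /predU1P[tE|/IH2//].
  by rewrite -tE /= IH1.
Qed.

End InnerLoop.

Section OuterLoop.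
Context {R : realType} {n : nat}.

Lemma grad_at_global_min (f : 'rV[R]_n -> R) x : (forall y, differentiable f y) ->
  (forall y, f x <= f y) -> grad f x = 0.
Proof.
move=> df fmin; apply/rowP => i; rewrite !mxE; set v := basis_vec i.
pose g (t : R) : R := f (x + t *: v).
have gE t : is_derive t (1 : R) g ('d f (x + t *: v) v) by exact/is_derive_line.
have : is_derive (0 : R) (1 : R) g 0.
  apply: (@derive1_at_min R g (-1) 1).
  - by lra.
  - by move=> t _; have [] := gE t.
  - by rewrite in_itv/=; lra.
  - by move=> t _; rewrite /g scale0r addr0.
have := gE 0; rewrite scale0r addr0 => -[_ <-] [_ ->].
by [].
Qed.

Section Iterations.
Variables (f : 'rV[R]_n -> R) (q m : nat) (L L0 eps f_low : R).
Variables (z : nat -> 'rV[R]_n) (Lk : nat -> R) (a : nat -> outcome) (c : nat -> nat).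
Hypotheses (n0 : (0 < n)%N) (m0 : (0 < m)%N) (L0_gt0 : 0 < L0) (eps0 : 0 < eps).
Hypotheses (tf : times_differentiable q.+1 f) (lf : lipschitz_derivative q.+1 f L).
Hypothesis f_lowP : forall x, f_low <= f x.
Hypothesis exec : execution f q.+1 m eps (z 0) L0 z Lk a c.
Let Lmax : R := Num.max L0 (2 * L).

Definition success_decrease : R := eps_pow q.+1 eps /
  (2 ^+ 6 * 3 `^ (q.+1%:R^-1) * sigma q.+1 m Lmax `^ (q.+1%:R^-1) * q.+2`!%:R) * m%:R.

Let Lmax0 : 0 < Lmax.
Proof. by rewrite lt_max L0_gt0. Qed.

Let mR0 : 0 < m%:R :> R.
Proof. by rewrite ltr0n. Qed.

Lemma sigma_gt0 (M : R) : 0 < M -> 0 < sigma q.+1 m M.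
Proof. by move=> M0; rewrite /sigma !mulr_gt0. Qed.

Lemma success_decrease_gt0 : 0 < success_decrease.
Proof.
rewrite /success_decrease mulr_gt0// divr_gt0 ?powR_gt0//.
by rewrite !mulr_gt0 ?exprn_gt0 ?powR_gt0 ?ltr0n ?fact_gt0// sigma_gt0.
Qed.

Lemma success_decrease_le x y (M : R) : 0 < M -> M <= Lmax ->
  enough_decrease f q.+1 (sigma q.+1 m M) eps x m.-1 y ->
  success_decrease <= f x - f y.
Proof.
move=> M0 MLmax; rewrite /enough_decrease prednK//; apply: le_trans.
have F2 : 0 < q.+2`!%:R :> R by rewrite ltr0n fact_gt0.
have s0 := sigma_gt0 M0; have s1 := sigma_gt0 Lmax0.
rewrite /success_decrease ler_wpM2r// ler_wpM2l ?powR_ge0//.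
rewrite lef_pV2 ?posrE ?mulr_gt0 ?exprn_gt0 ?powR_gt0//.
rewrite ler_wpM2r// ler_wpM2l ?mulr_ge0 ?exprn_ge0 ?powR_ge0//.
apply: ge0_ler_powR; rewrite ?invr_ge0// ?nnegrE; [exact: ltW|exact: ltW|].
by rewrite /sigma ler_wpM2r// ler_wpM2l.
Qed.

Lemma iterations_invariant K :
  (forall j, (j <= K)%N -> eps < enorm (grad f (z j))) ->
  exists S H : nat, [/\ 0 < Lk K <= Lmax, Lk K * 2 ^+ S = L0 * 2 ^+ H,
    (S + H)%N = K & S%:R * success_decrease <= f (z 0) - f (z K)].
Proof.
have [_ Lk0 step] := exec; elim: K => [|K IH] run.
  exists 0, 0; split; rewrite ?Lk0 ?subrr ?mul0r//.
  by rewrite L0_gt0 le_max lexx.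
have runK j : (j <= K)%N -> eps < enorm (grad f (z j)).
  by move=> jK; apply: run; exact: leqW.
have [S [H [/andP[LK0 LKm] LE SH dec]]] := IH runK.
have [lazy LS] := step K runK.
case aK : (a K) LS lazy => /= LS lazy.
- exists S.+1, H; split.
  + by rewrite LS divr_gt0//= ler_pdivrMr// (le_trans LKm)// ler_peMr ?ler1n// ltW.
  + by rewrite LS exprS mulrA divfK ?pnatr_eq0.
  + by rewrite addSn SH.
  + have [_ /(_ m0)] := lazy_loop_success lazy erefl (leq0n m).
    move=> /(success_decrease_le LK0 LKm) h.
    rewrite -natr1 mulrDl mul1r; apply: le_trans (lerD dec h) _.
    by rewrite le_eqVlt; apply/orP; left; apply/eqP; ring.
- have := lazy_loop_solution lazy erefl.
  by rewrite leNgt run.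
- have LKL : Lk K < L.
    rewrite ltNge; apply/negP => LLk.
    have lfk := lipschitz_derivative_le LLk lf.
    exact: (lazy_tensor_steps_no_halt n0 m0 LK0 eps0 tf lfk lazy).
  exists S, H.+1; split.
  + by rewrite LS mulr_gt0//= le_max ler_pM2l// (ltW LKL) orbT.
  + by rewrite LS exprS -mulrA LE mulrCA.
  + by rewrite addnS SH.
  + apply: le_trans dec _; rewrite lerD2l lerN2.
    exact: lazy_loop_le lazy _.
Qed.

Lemma iterations_bound l K : Lmax <= L0 * 2 ^+ l ->
  (forall j, (j <= K)%N -> eps < enorm (grad f (z j))) ->
  K%:R <= 2 * (f (z 0) - f_low) / success_decrease + l%:R.
Proof.
move=> Ll run; have [S [H [/andP[LK0 LKm] LE SH dec]]] := iterations_invariant run.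
have HS : (H <= S + l)%N.
  rewrite -(@ler_eXn2l _ (2 : R)) ?ltr1n// -(ler_pM2l L0_gt0) -LE exprD mulrCA.
  rewrite [leRHS]mulrC ler_wpM2r ?exprn_ge0//; exact: le_trans LKm Ll.
have SD : S%:R <= (f (z 0) - f_low) / success_decrease.
  rewrite ler_pdivlMr ?success_decrease_gt0//; apply: le_trans dec _.
  by rewrite lerD2l lerN2.
apply: (@le_trans _ _ (2 * S%:R + l%:R)).
  by rewrite -natrM -natrD ler_nat -SH; lia.
by rewrite lerD2r -mulrA ler_wpM2l.
Qed.

Lemma oracle_calls_bound l : Lmax <= L0 * 2 ^+ l ->
  exists2 K, stops_at f eps z K & (oracle_calls n c K)%:R <=
    (2 * (f (z 0) - f_low) / success_decrease + l%:R + 1) * (1 + n + 2 * m)%:R.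
Proof.
move=> Ll; set B := 2 * _ / _ + l%:R.
have B0 : 0 <= B.
  rewrite addr_ge0// divr_ge0//; first by rewrite mulr_ge0// subr_ge0.
  exact/ltW/success_decrease_gt0.
have exK : exists k, enorm (grad f (z k)) <= eps.
  apply: contrapT => /forallNP run.
  have run' j : eps < enorm (grad f (z j)) by rewrite ltNge; apply/negP.
  have := iterations_bound Ll (K := Num.bound B) (fun j _ => run' j).
  by rewrite -/B leNgt archi_boundP.
case: (ex_minnP exK) => K HK Kmin; exists K.
  by split=> // k kK; rewrite ltNge; apply/negP => /Kmin; rewrite leqNgt kK.
have run k : (k < K)%N -> eps < enorm (grad f (z k)).
  by move=> kK; rewrite ltNge; apply/negP => /Kmin; rewrite leqNgt kK.
have KB : K%:R <= B + 1.
  case: K run {HK Kmin} => [|K] run; first by rewrite addr_ge0.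
  rewrite -natr1 lerD2r; apply: iterations_bound => // j jK; exact: run.
apply: (@le_trans _ _ (K * (1 + n + 2 * m))%:R); last first.
  by rewrite natrM ler_wpM2r.
rewrite ler_nat /oracle_calls -[X in (_ <= X * _)%N]card_ord -sum_nat_const.
apply: leq_sum => k _; rewrite leq_add2l.
have [_ _ step] := exec.
have [|lazy _] := step k; first by move=> j jk; apply: run; exact: leq_ltn_trans jk _.
by have := lazy_loop_calls lazy (leq0n m); rewrite subn0.
Qed.

End Iterations.

End OuterLoop.

Lemma dimension_factor (R : realType) (n q m : nat) : (0 < n)%N -> m = (q * n + 1)%N ->
  (1 + n + 2 * m)%:R * m%:R `^ (q.+1%:R^-1) / m%:R
    <= 4 * q.+1%:R * n%:R `^ (q.+1%:R^-1) :> R.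
Proof.
case: q => [|q] n0 mE.
  rewrite mE mul0n add0n invr1 !powRr1// !mulr1 -natrM ler_nat; lia.
set k : R := q.+2%:R^-1.
have k0 : 0 <= k by rewrite invr_ge0.
have k1 : k <= 1 by rewrite invf_le1 ?ler1n.
have m0 : 0 < m%:R :> R by rewrite ltr0n mE addn1.
have N4 : (1 + n + 2 * m)%:R <= 4 * m%:R :> R.
  by rewrite -natrM ler_nat mE mulSn; lia.
have mn : m%:R `^ k <= q.+2%:R * n%:R `^ k.
  apply: (@le_trans _ _ ((q.+2%:R * n%:R) `^ k)).
    apply: ge0_ler_powR; rewrite ?nnegrE// ?mulr_ge0//.
    by rewrite -natrM ler_nat mE !mulSn; lia.
  rewrite powRM// ler_wpM2r ?powR_ge0//.
  by rewrite ler1_powR ?ler1n.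
rewrite ler_pdivrMr//.
apply: (@le_trans _ _ (4 * m%:R * (q.+2%:R * n%:R `^ k))).
  by rewrite ler_pM ?powR_ge0.
by rewrite le_eqVlt; apply/orP; left; apply/eqP; ring.
Qed.

Lemma main_term_bound (R : realType) (n q m : nat) (L L0 eps : R) : (0 < n)%N ->
  m = (q * n + 1)%N -> 0 < L0 -> 0 < eps ->
  (1 + n + 2 * m)%:R / success_decrease q m L L0 eps <=
    64 * 3 * (11 * q.+2%:R) * q.+2`!%:R * (4 * q.+1%:R) *
    (n%:R `^ (q.+1%:R^-1) * Num.max L0 (2 * L) `^ (q.+1%:R^-1)
     * eps `^ (- (q.+2%:R / q.+1%:R))).
Proof.
move=> n0 mE L00 eps0; set k : R := q.+1%:R^-1; set M := Num.max _ _.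
have k0 : 0 <= k by rewrite invr_ge0.
have k1 : k <= 1 by rewrite invf_le1 ?ler1n.
have M0 : 0 < M by rewrite lt_max L00.
have m0 : 0 < m%:R :> R by rewrite ltr0n mE addn1.
rewrite /success_decrease -/k -/M /sigma.
have K3 : 3 `^ k <= 3 :> R by rewrite ler1_powR// ler1n.
have KP : (11 * q.+2%:R) `^ k <= 11 * q.+2%:R :> R.
  by rewrite ler1_powR// -natrM ler1n.
have D := dimension_factor R n0 mE; rewrite -/k in D.
rewrite powRM ?mulr_ge0 ?(ltW M0)// powRM ?mulr_ge0 ?(ltW M0)//.
rewrite powRN /eps_pow.
set E := eps `^ _; have E0 : 0 < E by rewrite powR_gt0.
set Mk := M `^ k; have Mk0 : 0 <= Mk by rewrite powR_ge0.
set F : R := q.+2`!%:R; have F0 : 0 < F by rewrite ltr0n fact_gt0.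
rewrite (_ : 2 ^+ 6 = 64 :> R); last by ring.
have p3 : 0 < 3 `^ k :> R by rewrite powR_gt0.
have pP : 0 < (11 * q.+2%:R) `^ k :> R by rewrite powR_gt0// mulr_gt0.
have pm : 0 < m%:R `^ k by rewrite powR_gt0.
have Mk1 : 0 < Mk by rewrite powR_gt0.
have -> : (1 + n + 2 * m)%:R / (E / (64 * 3 `^ k *
    ((11 * q.+2%:R) `^ k * Mk * m%:R `^ k) * F) * m%:R) =
    (64 * F * Mk / E) * (3 `^ k * ((11 * q.+2%:R) `^ k *
    ((1 + n + 2 * m)%:R * m%:R `^ k / m%:R))).
  move: (m%:R `^ k) pm (3 `^ k) p3 (_ `^ k) pP => w w0 a a0 b b0.
  by field; rewrite !gt_eqF.
have -> : 64 * 3 * (11 * q.+2%:R) * F * (4 * q.+1%:R) * (n%:R `^ k * Mk / E) =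
    (64 * F * Mk / E) * (3 * ((11 * q.+2%:R) * (4 * q.+1%:R * n%:R `^ k))).
  by ring.
rewrite ler_wpM2l ?divr_ge0 ?mulr_ge0 ?(ltW E0) ?(ltW F0)//.
have X0 : 0 <= (1 + n + 2 * m)%:R * m%:R `^ k / m%:R.
  by rewrite divr_ge0 ?mulr_ge0 ?powR_ge0.
by rewrite ler_pM ?mulr_ge0 ?powR_ge0// ler_pM ?powR_ge0.
Qed.

(* The constant C hidden in the O depends only on p. The bound is asymptotic as
   eps tends to 0, and its threshold eps0 depends on f, z0 and f_low only
   through n, L and the initial gap f z0 - f_low. *)
Theorem corollary3p6 (R : realType) (p : nat) (hp : (1 <= p)%N) :
  exists2 C : R, 0 < C &
  forall (n : nat) (L L0 gap : R), 0 < L0 ->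
  exists2 eps0 : R, 0 < eps0 &
  forall (f : 'rV[R]_n -> R) (f_low : R) (z0 : 'rV[R]_n) (eps : R),
    times_differentiable p f ->
    (forall x y : 'rV[R]_n,
       form_norm p (fun hs => nabla f x hs - nabla f y hs)
         <= L * enorm (x - y)) ->
    (forall x : 'rV[R]_n, f_low <= f x) ->
    f z0 - f_low = gap ->
    0 < eps -> eps <= eps0 ->
    forall (z : nat -> 'rV[R]_n) (Lk : nat -> R)
           (a : nat -> outcome) (c : nat -> nat),
      execution f p (p.-1 * n + 1) eps z0 L0 z Lk a c ->
      exists2 K : nat, stops_at f eps z K &
        (oracle_calls n c K)%:R <=
          C * (n%:R `^ (p%:R^-1) * Num.max L0 (2 * L) `^ (p%:R^-1)
               * (f z0 - f_low) * eps `^ (- (p.+1%:R / p%:R))).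
Proof.
case: p hp => // q _; rewrite [q.+1.-1]/=.
set C1 : R := 64 * 3 * (11 * q.+2%:R) * q.+2`!%:R * (4 * q.+1%:R).
have C10 : 0 <= C1 by rewrite !mulr_ge0.
exists (2 * C1 + 1); first by rewrite ltr_wpDl// mulr_ge0.
move=> n L L0 gap L00; set M := Num.max L0 (2 * L).
have M0 : 0 < M by rewrite lt_max L00.
pose m := (q * n + 1)%N; pose N : R := (1 + n + 2 * m)%:R.
have [l Ml] : exists l, M <= L0 * 2 ^+ l.
  exists (Num.bound (M / L0)); rewrite mulrC -ler_pdivrMr//.
  by rewrite ltW// upper_nthrootP.
pose X := (l%:R + 1) * N / (n%:R `^ (q.+1%:R^-1) * M `^ (q.+1%:R^-1) * gap).
have [ng|ng] := boolP ((0 < n)%N && (0 < gap)); last first.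
  exists 1 => // f f_low z0 eps tf _ f_lowP gapE eps0 _ z Lk a c [zE _ _].
  have gap_ge0 : 0 <= gap by rewrite -gapE subr_ge0.
  have g0 : grad f z0 = 0.
    move: ng; rewrite negb_and lt0n negbK => /orP[/eqP n0|].
      by apply/rowP => -[i lt_i]; exfalso; move: (lt_i); rewrite n0.
    rewrite -leNgt => gap_le0; apply: grad_at_global_min => [|y]; first by case: tf.
    by have := f_lowP y; lra.
  exists 0%N; first by split=> //; rewrite zE g0 enorm0 ltW.
  rewrite /oracle_calls big_ord0 gapE !mulr_ge0 ?powR_ge0//.
  by rewrite addr_ge0// mulr_ge0.
have /andP[n0 gap0] := ng.
have W0 : 0 < n%:R `^ (q.+1%:R^-1) * M `^ (q.+1%:R^-1) * gap.
  by rewrite !mulr_gt0 ?powR_gt0 ?ltr0n.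
have X0 : 0 < X by rewrite divr_gt0// mulr_gt0 ?ltr0n ?addn_gt0// ltr_wpDl.
exists (Num.min 1 X^-1); first by rewrite lt_min ltr01 invr_gt0.
move=> f f_low z0 eps tf lf f_lowP gapE eps0; rewrite le_min => /andP[eps1 epsX].
move=> z Lk a c exec; have zE : z 0%N = z0 by case: exec.
rewrite -zE in exec gapE *.
have m0 : (0 < m)%N by rewrite /m addn1.
have lipf := lipschitz_derivative_form_norm tf lf.
have [K stopK callsK] :=
  oracle_calls_bound n0 m0 L00 eps0 tf lipf f_lowP exec Ml.
exists K => //; apply: le_trans callsK _; rewrite gapE.
have MT := main_term_bound L n0 (erefl m) L00 eps0; rewrite -/C1 -/M -/N in MT.
set D := success_decrease _ _ _ _ _ in MT *.
set E := eps `^ _ in MT *; rewrite -/N.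
have -> : (2 * gap / D + l%:R + 1) * N = 2 * gap * (N / D) + (l%:R + 1) * N by ring.
rewrite [leRHS]mulrDl mul1r lerD//.
  apply: le_trans (ler_wpM2l _ MT) _; first by rewrite mulr_ge0// ltW.
  by rewrite le_eqVlt; apply/orP; left; apply/eqP; ring.
have EX : X <= E.
  apply: (@le_trans _ _ eps^-1).
    by rewrite -[leLHS]invrK lef_pV2 ?posrE ?invr_gt0.
  rewrite /E powRN lef_pV2 ?posrE ?powR_gt0//.
  rewrite ge1r_powR// ?eps0//.
  by rewrite ler_pdivlMr// mul1r ler_nat.
apply: le_trans _ (ler_wpM2l (ltW W0) EX).
by rewrite /X [leRHS]mulrC divfK// gt_eqF.
Qed.
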